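(* Assume that $Y_V$ satisfies the spectral density condition and is purely non-deterministic. (a) Let $G_{OG}=(V,E_{OG})$ be the orthogonality graph for $Y_V$, with parent sets $\mathrm{pa}(a)$ and neighbour sets $\mathrm{ne}(a)$ formed in $G_{OG}$. Then $Y_V$ satisfies the local Markov property with respect to $G_{OG}$, i.e., for all $a\in V$: (i) $Y_{V\setminus(\mathrm{pa}(a)\cup\{a\})}\not\to Y_a\mid Y_V$, (ii) $Y_{V\setminus(\mathrm{ne}(a)\cup\{a\})}\not\sim Y_a\mid Y_V$. (b) Suppose moreover that every component $Y_v$, $v\in V$, is $j_v$-times mean-square differentiable but not $(j_v+1)$-times, and let $G^0_{OG}=(V,E^0_{OG})$ be the local orthogonality graph for $Y_V$, with $\mathrm{pa}(a)$ and $\mathrm{ne}(a)$ formed in $G^0_{OG}$. Then $Y_V$ satisfies the local Markov property with respect to $G^0_{OG}$, i.e., for all $a\in V$: (i) $Y_{V\setminus(\mathrm{pa}(a)\cup\{a\})}\not\to_0 Y_a\mid Y_V$, (ii) $Y_{V\setminus(\mathrm{ne}(a)\cup\{a\})}\not\sim_0 Y_a\mid Y_V$.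
   Context: $V=\{1,\ldots,k\}$ and $Y_V=(Y_V(t))_{t\in\mathbb{R}}$ is a $k$-dimensional weakly stationary process with expectation zero, continuous in mean square, with components $Y_v$ and subprocesses $Y_A=(Y_a)_{a\in A}$. $L^2$ is the Hilbert space of square-integrable complex random variables with $\langle X,Y\rangle=\mathbb{E}[X\overline{Y}]$; $P_{\mathcal L}$ is orthogonal projection onto a closed subspace. $\mathcal{L}_{Y_A}(s,t)$ is the closed linear span of $\{Y_a(u):a\in A,u\in[s,t]\cap\mathbb{R}\}$ and $\mathcal{L}_{Y_A}(t)=\mathcal{L}_{Y_A}(-\infty,t)$ ($=\{0\}$ if $A=\emptyset$). $\mathcal{L}_1\perp\mathcal{L}_2\mid\mathcal{L}_3$ means $\mathbb{E}[(X-P_{\mathcal{L}_3}X)\overline{(Y-P_{\mathcal{L}_3}Y)}]=0$ for all $X\in\mathcal{L}_1,Y\in\mathcal{L}_2$. $D^{(j)}$ denotes the $j$-th mean-square derivative, $D^{(0)}Y_v=Y_v$; l.i.m. is the $L^2$-limit. Relations, for $A,B\subseteq S\subseteq V$, $A\cap B=\emptyset$ (all relations are understood to hold trivially if $A$ or $B$ is empty): - $Y_A\not\to Y_B\mid Y_S$: $\mathcal{L}_{Y_B}(t,t+1)\perp\mathcal{L}_{Y_A}(t)\mid\mathcal{L}_{Y_{S\setminus A}}(t)$ for all $t\in\mathbb{R}$. - $Y_A\not\sim Y_B\mid Y_S$: $\mathcal{L}_{Y_A}(t,t+1)\perp\mathcal{L}_{Y_B}(t,t+1)\mid\mathcal{L}_{Y_S}(t)$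 for all $t\in\mathbb{R}$. - $Y_A\not\to_0 Y_B\mid Y_S$: for all $t\in\mathbb{R}$, $b\in B$, with $Q_{b,h}=h^{-1}(D^{(j_b)}Y_b(t+h)-D^{(j_b)}Y_b(t))$, the limits $\mathrm{l.i.m.}_{h\downarrow0}P_{\mathcal{L}_{Y_S}(t)}Q_{b,h}$ and $\mathrm{l.i.m.}_{h\downarrow0}P_{\mathcal{L}_{Y_{S\setminus A}}(t)}Q_{b,h}$ exist and are a.s. equal. - $Y_A\not\sim_0 Y_B\mid Y_S$: for all $t\in\mathbb{R}$, $a\in A$, $b\in B$, $\lim_{h\downarrow0}\frac1h\mathbb{E}[(D^{(j_a)}Y_a(t+h)-P_{\mathcal{L}_{Y_S}(t)}D^{(j_a)}Y_a(t+h))\overline{(D^{(j_b)}Y_b(t+h)-P_{\mathcal{L}_{Y_S}(t)}D^{(j_b)}Y_b(t+h))}]=0$. Spectral density condition: $Y_V$ has a spectral density matrix $f_{Y_VY_V}(\cdot)>0$ (positive definite) and there is $0<\varepsilon<1$ such that $(1-\varepsilon)I_\alpha-f_{Y_AY_A}(\lambda)^{-1/2}f_{Y_AY_B}(\lambda)f_{Y_BY_B}(\lambda)^{-1}f_{Y_BY_A}(\lambda)f_{Y_AY_A}(\lambda)^{-1/2}$ is positive semi-definite for almost all $\lambda\in\mathbb{R}$ and all disjoint $A,B\subseteq V$, $\#A=\alpha$ (here $f_{Y_AY_B}$ is the $A\times B$ block of $f_{Y_VY_V}$). Purely non-deterministic: $\bigcap_{t\in\mathbb{R}}\mathcal{L}_{Y_V}(t)=\{0\}$.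 Graphs: both have vertex set $V$, directed edges $a\to b$ and undirected edges $a\,\text{-}\,\text{-}\,b$ for $a\ne b$. In the orthogonality graph $G_{OG}$: $a\to b\notin E_{OG}$ iff $Y_a\not\to Y_b\mid Y_V$, and $a\,\text{-}\,\text{-}\,b\notin E_{OG}$ iff $Y_a\not\sim Y_b\mid Y_V$. In the local orthogonality graph $G_{OG}^0$: $a\to b\notin E^0_{OG}$ iff $Y_a\not\to_0Y_b\mid Y_V$, and $a\,\text{-}\,\text{-}\,b\notin E^0_{OG}$ iff $Y_a\not\sim_0Y_b\mid Y_V$. $\mathrm{pa}(a)=\{v\in V:v\to a\in E\}$, $\mathrm{ne}(a)=\{v\in V:v\,\text{-}\,\text{-}\,a\in E\}$. *)

(* Defs.v *)
From HB Require Import structures.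
From mathcomp Require Import all_boot all_order all_algebra.
From mathcomp Require Import spectral sesquilinear complex.
From mathcomp Require Import all_classical all_reals all_analysis.

Set Implicit Arguments.
Unset Strict Implicit.
Unset Printing Implicit Defensive.

Import Order.TTheory GRing.Theory Num.Theory.
Import numFieldNormedType.Exports.

Local Open Scope classical_set_scope.
Local Open Scope ring_scope.
Local Open Scope complex_scope.

Section ComplexIntegral.
Context d (T : measurableType d) (R : realType) (mu : {measure set T -> \bar R}).

Definition cintegrable (g : T -> R[i]) : Prop :=
  mu.-integrable setT (fun x => (complex.Re (g x))%:E) /\
  mu.-integrable setT (fun x => (complex.Im (g x))%:E).

Definition cintegral (g : T -> R[i]) : R[i] :=
  (Rintegral mu setT (fun x => complex.Re (g x))) +i*
  (Rintegral mu setT (fun x => complex.Im (g x))).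

Lemma cintegral_conj (g : T -> R[i]) :
  cintegral (fun x => conjc (g x)) = conjc (cintegral g).
Proof.
have RN (u : T -> R) :
    Rintegral mu setT (fun x => - u x) = - Rintegral mu setT u.
  have E : (fun x => (- u x)%:E) = (\- (EFin \o u))%E by [].
  rewrite /Rintegral E integralE funeposN funenegN [in RHS]integralE.
  have : (0 <= \int[mu]_x (EFin \o u)^\- x)%E by apply: integral_ge0.
  have : (0 <= \int[mu]_x (EFin \o u)^\+ x)%E by apply: integral_ge0.
  case: (\int[mu]_x (EFin \o u)^\+ x)%E => [p| |] //= _;
  case: (\int[mu]_x (EFin \o u)^\- x)%E => [q| |] //= _; rewrite ?oppr0 //.
  by rewrite opprB.
rewrite /cintegral /=; congr (_ +i* _).
  by congr (fine _); apply: eq_integral => x _; case: (g x).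
by rewrite -RN; congr (fine _); apply: eq_integral => x _; case: (g x).
Qed.

End ComplexIntegral.

Section L2.
Context d (T : measurableType d) (R : realType) (P : probability T R).
Implicit Types (X Y Z : T -> R[i]) (L : set (T -> R[i])).

(* Elements of L^2 are represented by functions; equality in L^2 is {ae P}. *)
Definition L2 : set (T -> R[i]) :=
  [set X | (fun w => complex.Re (X w)) \in Lfun P 2%:E /\
           (fun w => complex.Im (X w)) \in Lfun P 2%:E].

Definition cexpect X : R[i] := cintegral P X.

Definition inner X Y : R[i] := cexpect (fun w => X w * conjc (Y w)).

Definition msnorm X : R := Num.sqrt (complex.Re (inner X X)).

Definition lim_ms (I : Type) (F : set_system I) (Z : I -> T -> R[i]) X : Prop :=
  L2 X /\ (fun i => msnorm (Z i \- X)) @ F --> (0 : R).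

Definition lin_span (G : set (T -> R[i])) : set (T -> R[i]) :=
  [set X | exists (n : nat) (c : 'I_n -> R[i]) (g : 'I_n -> T -> R[i]),
     (forall i, G (g i)) /\ X = (fun w => \sum_(i < n) c i * g i w)].

Definition closed_lin_span (G : set (T -> R[i])) : set (T -> R[i]) :=
  [set X | L2 X /\
     forall e : R, 0 < e -> exists2 Z, lin_span G Z & msnorm (X \- Z) < e].

Definition is_proj L X Z : Prop :=
  L Z /\ forall W, L W -> inner (X \- Z) W = 0.

Definition proj L X : T -> R[i] := xget (cst 0) [set Z | is_proj L X Z].

Definition cond_orth (L1 L2 L3 : set (T -> R[i])) : Prop :=
  forall X Y, L1 X -> L2 Y -> inner (X \- proj L3 X) (Y \- proj L3 Y) = 0.

Lemma innerC X Y : inner Y X = conjc (inner X Y).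
Proof.
rewrite /inner /cexpect -cintegral_conj; congr cintegral.
by apply/funext => w; rewrite rmorphM /= conjcK mulrC.
Qed.

Lemma cond_orthC (L1 L2 L3 : set (T -> R[i])) :
  cond_orth L1 L2 L3 -> cond_orth L2 L1 L3.
Proof. by move=> o X Y LX LY; rewrite innerC o// rmorph0. Qed.

Definition diff_quot (Z : R -> T -> R[i]) (t h : R) : T -> R[i] :=
  fun w => (h^-1)%:C * (Z (t + h) w - Z t w).

(* takes the junk value 0 where the mean-square limit does not exist *)
Definition msD (Z : R -> T -> R[i]) : R -> T -> R[i] :=
  fun t => xget (cst 0) [set X | lim_ms 0^' (diff_quot Z t) X].

Definition ms_differentiable (Z : R -> T -> R[i]) : Prop :=
  forall t, exists X, lim_ms 0^' (diff_quot Z t) X.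

Definition msDn (n : nat) (Z : R -> T -> R[i]) : R -> T -> R[i] :=
  iter n msD Z.

Definition ms_differentiable_n (n : nat) (Z : R -> T -> R[i]) : Prop :=
  forall i, (i < n)%N -> ms_differentiable (msDn i Z).

End L2.

Section HermitianMatrices.
Context (C : numClosedFieldType).
Local Open Scope sesquilinear_scope.

Definition posdefmx n (M : 'M[C]_n) : Prop :=
  M \is hermsymmx /\
  forall x : 'cV[C]_n, x != 0 -> 0 < (x^t* *m M *m x) ord0 ord0.

Definition possemidefmx n (M : 'M[C]_n) : Prop :=
  M \is hermsymmx /\ forall x : 'cV[C]_n, 0 <= (x^t* *m M *m x) ord0 ord0.

(* Since M = U^-1 diag(s) U with U unitary for Hermitian M, this is the positive
   semi-definite square root when M is positive semi-definite. *)
Definition sqrtmx n (M : 'M[C]_n) : 'M[C]_n :=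
  invmx (spectralmx M) *m diag_mx (map_mx sqrtC (spectral_diag M))
    *m spectralmx M.

Lemma sqrtmxK n (M : 'M[C]_n) : M \is hermsymmx -> sqrtmx M *m sqrtmx M = M.
Proof.
move=> /hermitian_normalmx /orthomx_spectralP ME; rewrite [RHS]ME.
rewrite /sqrtmx !mulmxA mulmxK ?spectral_unit//.
rewrite -[in LHS](mulmxA (invmx _) (diag_mx _)) mulmx_diag.
congr (_ *m diag_mx _ *m _); apply/rowP => i.
by rewrite !mxE -expr2 sqrtCK.
Qed.

Lemma sqrtmx_possemidef n (M : 'M[C]_n) :
  possemidefmx M -> possemidefmx (sqrtmx M).
Proof.
move=> [hM psdM]; set U := spectralmx M; set s := spectral_diag M.
have Uu : U *m U^t* = 1%:M by apply/unitarymxP/spectral_unitarymx.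
have iU : invmx U = U^t* by rewrite invmx_unitary ?spectral_unitarymx.
have ME : M = U^t* *m diag_mx s *m U.
  by rewrite -iU; apply/orthomx_spectralP/hermitian_normalmx.
have s_ge0 i : 0 <= s 0 i.
  have := psdM (U^t* *m delta_mx i ord0).
  rewrite [X in _ *m X *m _]ME trmx_mul map_mxM /= trmxCK !mulmxA.
  rewrite -(mulmxA _ U (U^t*)) Uu mulmx1 -(mulmxA _ U (U^t*)) Uu mulmx1.
  rewrite -mulmxA mul_diag_mx mxE (bigD1 i)//= big1 ?addr0.
    by rewrite !mxE !eqxx /= mulr1 conjC1 mul1r.
  by move=> m /negPf mi; rewrite !mxE mi /= mulr0 mulr0.
have E : sqrtmx M = U^t* *m diag_mx (map_mx sqrtC s) *m U by rewrite -iU.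
have dh : (diag_mx (map_mx sqrtC s))^t* = diag_mx (map_mx sqrtC s).
  rewrite tr_diag_mx map_diag_mx; congr diag_mx; apply/rowP => i.
  by rewrite !mxE; apply: CrealP; rewrite ger0_real// sqrtC_ge0.
split.
  apply/is_hermitianmxP; rewrite expr0 scale1r E !trmx_mul !map_mxM /=.
  by rewrite dh trmxCK mulmxA.
move=> x; rewrite E -!mulmxA mulmxA -[X in X *m _](trmxCK).
rewrite (trmx_mul (x^t*)) map_mxM /= !trmxCK mul_diag_mx.
rewrite mxE sumr_ge0// => i _; rewrite !mxE mulrCA mulr_ge0 ?sqrtC_ge0//.
by rewrite mulrC -normCK exprn_ge0.
Qed.

End HermitianMatrices.

Definition submx_of k (C : Type) (M : 'M[C]_k) (A B : {set 'I_k}) :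
    'M[C]_(#|A|, #|B|) :=
  \matrix_(i < #|A|, j < #|B|) M (enum_val i) (enum_val j).

Lemma cvg0_conj (R : realType) (I : Type) (F : set_system I) (FF : Filter F)
    (c z : I -> R[i]) :
  (fun i => c i * z i : R[i]^o) @ F --> (0 : R[i]^o) ->
  (fun i => c i * conjc (z i) : R[i]^o) @ F --> (0 : R[i]^o).
Proof.
move=> /cvgr0Pnorm_lt H; apply/cvgr0Pnorm_lt => e e0; move: (H e e0).
apply: filterS => i.
have N (a b : R[i]) : `|a * conjc b| = `|a * b|.
  by rewrite !normrM !normc_def; case: b => x y /=; rewrite sqrrN.
by move=> h; apply: le_lt_trans h; rewrite -[leLHS]/`|c i * conjc (z i)| N.
Qed.

Section Process.
Context d (T : measurableType d) (R : realType) (P : probability T R) (k : nat).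
Context (Y : 'I_k -> R -> T -> R[i]).
Implicit Types A B S : {set 'I_k}.

Definition weakly_stationary_centered : Prop :=
  [/\ forall v (t : R), L2 P (Y v t),
      forall v (t : R), cexpect P (Y v t) = 0 &
      forall a b (s t : R),
        inner P (Y a (s + t)) (Y b s) = inner P (Y a t) (Y b 0)].

Definition ms_continuous : Prop :=
  forall v (t : R), lim_ms P (nbhs t) (Y v) (Y v t).

(* s is extended-real so that s = -oo gives the whole past *)
Definition Lspan A (s t : \bar R) : set (T -> R[i]) :=
  closed_lin_span P
    [set X | exists a (u : R), [/\ a \in A, (s <= u%:E <= t)%E & X = Y a u]].

Definition Lpast A (t : R) : set (T -> R[i]) := Lspan A -oo%E t%:E.

Definition purely_nondeterministic : Prop :=
  forall X, (forall t, Lpast [set: 'I_k]%SET t X) -> {ae P, forall w, X w = 0}.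

Definition is_spectral_density (f : R -> 'M[R[i]]_k) : Prop :=
  forall a b, cintegrable lebesgue_measure (fun l : R => f l a b) /\
    forall s t : R, inner P (Y a (s + t)) (Y b s) =
      cintegral lebesgue_measure
        (fun l : R => (cos (l * t) +i* sin (l * t)) * f l a b).

Definition spectral_density_condition : Prop :=
  exists f : R -> 'M[R[i]]_k,
    [/\ is_spectral_density f,
        forall l, posdefmx (f l) &
        exists e : R, 0 < e < 1 /\
          forall A B, (A :&: B)%SET = finset.set0 ->
          {ae lebesgue_measure, forall l : R,
            let fAA := submx_of (f l) A A in let fAB := submx_of (f l) A B in
            let fBA := submx_of (f l) B A in let fBB := submx_of (f l) B B in
            let fAA_isqrt := invmx (sqrtmx fAA) in
            possemidefmx (((1 - e)%:C)%:M -
              fAA_isqrt *m fAB *m invmx fBB *m fBA *m fAA_isqrt)}].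

(* The four relations are only meant for disjoint A, B contained in S, and hold
   by convention when A or B is empty. *)
Definition not_causes A B S : Prop :=
  A = finset.set0 \/ B = finset.set0 \/
  forall t : R,
    cond_orth P (Lspan B t%:E (t + 1)%:E) (Lpast A t) (Lpast (S :\: A)%SET t).

Definition not_sim A B S : Prop :=
  A = finset.set0 \/ B = finset.set0 \/
  forall t : R,
    cond_orth P (Lspan A t%:E (t + 1)%:E) (Lspan B t%:E (t + 1)%:E) (Lpast S t).

Context (j : 'I_k -> nat).

Definition Dj v : R -> T -> R[i] := msDn P (j v) (Y v).

Definition not_causes0 A B S : Prop :=
  A = finset.set0 \/ B = finset.set0 \/
  forall (t : R) b, b \in B ->
    exists Z1 Z2,
      [/\ lim_ms P 0^'+
            (fun h => proj P (Lpast S t) (diff_quot (Dj b) t h)) Z1,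
          lim_ms P 0^'+
            (fun h => proj P (Lpast (S :\: A)%SET t) (diff_quot (Dj b) t h)) Z2 &
          {ae P, forall w, Z1 w = Z2 w}].

Definition innov v S (t h : R) : T -> R[i] :=
  Dj v (t + h) \- proj P (Lpast S t) (Dj v (t + h)).

Definition not_sim0 A B S : Prop :=
  A = finset.set0 \/ B = finset.set0 \/
  forall (t : R) a b, a \in A -> b \in B ->
    ((fun h : R => (h^-1)%:C * inner P (innov a S t h) (innov b S t h) : R[i]^o)
       @ 0^'+ --> (0 : R[i]^o)).

Lemma not_simC A B S : not_sim A B S -> not_sim B A S.
Proof.
case=> [->|[->|h]]; [by right; left|by left|].
by right; right=> t; exact/cond_orthC.
Qed.

Lemma not_sim0C A B S : not_sim0 A B S -> not_sim0 B A S.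
Proof.
case=> [->|[->|H]]; [by right; left|by left|right; right=> t a b aB bA].
rewrite [X in X @ _](_ : _ = (fun h : R => (h^-1)%:C *
    conjc (inner P (innov b S t h) (innov a S t h)) : R[i]^o)); last first.
  by apply/funext => h; congr (_ * _); exact: innerC.
by apply: cvg0_conj; exact: H.
Qed.

End Process.

Record mixed_graph (V : finType) := MixedGraph {
  dedge : rel V;
  uedge : rel V;
  dedge_irr : irreflexive dedge;
  uedge_irr : irreflexive uedge;
  uedge_sym : symmetric uedge }.

Definition pa (V : finType) (G : mixed_graph V) (a : V) : {set V} :=
  [set v | dedge G v a]%SET.

Definition ne (V : finType) (G : mixed_graph V) (a : V) : {set V} :=
  [set v | uedge G v a]%SET.

Section PairwiseGraph.
Context (V : finType) (nto nsim : {set V} -> {set V} -> {set V} -> Prop).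
Context (nsimC : forall A B S, nsim A B S -> nsim B A S).

Let de : rel V := fun a b =>
  (a != b) && ~~ `[< nto [set a]%SET [set b]%SET [set: V]%SET >].
Let ue : rel V := fun a b =>
  (a != b) && ~~ `[< nsim [set a]%SET [set b]%SET [set: V]%SET >].

Fact pairwise_de_irr : irreflexive de. Proof. by move=> a; rewrite /de eqxx. Qed.
Fact pairwise_ue_irr : irreflexive ue. Proof. by move=> a; rewrite /ue eqxx. Qed.
Fact pairwise_ue_sym : symmetric ue.
Proof.
move=> a b; rewrite /ue eq_sym; congr (_ && ~~ _).
by apply/asboolP/asboolP; exact: nsimC.
Qed.

Definition pairwise_graph : mixed_graph V :=
  MixedGraph pairwise_de_irr pairwise_ue_irr pairwise_ue_sym.

End PairwiseGraph.

Section OrthogonalityGraphs.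
Context d (T : measurableType d) (R : realType) (P : probability T R) (k : nat).
Context (Y : 'I_k -> R -> T -> R[i]).

Definition orthogonality_graph : mixed_graph 'I_k :=
  pairwise_graph (not_causes P Y) (@not_simC _ _ _ P _ Y).

Definition local_orthogonality_graph (j : 'I_k -> nat) : mixed_graph 'I_k :=
  pairwise_graph (not_causes0 P Y j) (@not_sim0C _ _ _ P _ Y j).

End OrthogonalityGraphs.

Definition local_markov (V : finType)
    (nto nsim : {set V} -> {set V} -> {set V} -> Prop) (G : mixed_graph V) : Prop :=
  forall a : V,
    nto (~: (pa G a :|: [set a]))%SET [set a]%SET [set: V]%SET /\
    nsim (~: (ne G a :|: [set a]))%SET [set a]%SET [set: V]%SET.

(* Main.v *)
Require Import Defs.
From HB Require Import structures.
From mathcomp Require Import all_boot all_order all_algebra complex.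
From mathcomp Require Import spectral sesquilinear.
From mathcomp Require Import all_classical all_reals all_analysis.
From mathcomp Require Import measurable_realfun ring lra.

Set Implicit Arguments.
Unset Strict Implicit.
Unset Printing Implicit Defensive.

Local Open Scope complex_scope.

(** Each relation is a statement about orthogonal projections onto closed
    subspaces of the space of square-integrable random variables, and the local
    Markov property says that it passes from the single components [v] of a set
    [A] to [A] itself. How much work this takes depends on where [A] occurs.

    In the two contemporaneous relations [A] only supplies one of the two
    variables, the conditioning past being that of all components. The claim
    then follows by linearity and continuity of the inner product
    ([not_sim_union]), or already holds element by element in the local version.

    In the two causal relations [A] is also removed from the conditioning past.
    Non-causality of [A] for [B] means that the projection of the future of [B]
    onto the past of all components lies in the past of the components outside
    [A] ([cond_orth_is_proj], [is_proj_cond_orth]); in the local version the same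
    is said of the mean-square limit of the projected difference quotients. From
    the relations for every single [v] in [A] one gets an element lying in the
    past of all components but [v], for every [v] in [A], and one needs it to
    lie in the past of the components outside [A]. So everything rests on
      past of [S] /\ past of [S'] = past of [S :&: S'],
    which is [Lspan_capI].

    This identity is where the spectral density condition enters. The spectral
    representation turns the squared norm of a finite linear combination of the
    variables [Y v u] into the integral of [x^* f x], where [x] is the vector of
    the trigonometric polynomials attached to the components ([spectral_isometry]).
    For almost every frequency the condition says that the Schur complement of
    [f] on the block [A] is at least [e] times that block, so completing the
    square in the other coordinates gives [e * (x_A^* f x_A) <= x^* f x]
    ([schur_angle]). Integrating, the part of a linear combination carried by
    the components in [A] is controlled in norm by the whole combination
    ([angle_bound]): disjoint sets of components span spaces at a positive angle.
    If now [Z] in the span of [S] and [Z'] in that of [S'] are both close to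
    [X], then [Z - Z'] is small, hence so is the part of [Z] carried by
    [S :\: S']; deleting it from [Z] gives an approximation of [X] in the span
    of [S :&: S'].

    Projections onto closed subspaces exist because the space of
    square-integrable random variables is complete ([Lfun2_complete],
    [L2_complete]). Random variables are functions here, not classes modulo
    almost sure equality, so the inner product is only semidefinite and
    uniqueness statements take the form [msnorm (Z - Z') = 0]. *)

Import Order.TTheory GRing.Theory Num.Theory.
Import numFieldNormedType.Exports.
Local Open Scope classical_set_scope.
Local Open Scope ring_scope.

(** * Completeness of the space of square-integrable functions *)
Section RieszFischer.
Context d (T : measurableType d) (R : realType) (P : probability T R).
Implicit Types f g : T -> R.

Lemma Lfun2P f : f \in Lfun P 2%:E <->
  measurable_fun setT f /\ P.-integrable setT (EFin \o (fun x => f x ^+ 2)).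
Proof.
split=> [fL|[mf intf]].
  split; last exact: Lfun2_integrable_sqr.
  by move: fL => /andP[]; rewrite inE.
rewrite inE; apply/andP; split; rewrite inE//= /finite_norm unlock.
rewrite poweR_lty//; move: intf => /integrableP[_]; apply: le_lt_trans.
by under eq_integral => x _ do rewrite /= powR_mulrn// -normrX.
Qed.

(** Integrate [s * |y| <= (s * y) ^+ 2 + 1] and divide by [s]. A large [s] makes
    the first moment small as soon as the second moment is very small. *)
Lemma integral_norm_le_sqr f (s : R) : 0 < s -> f \in Lfun P 2%:E ->
  (\int[P]_x `|f x|%:E <= (s * Rintegral P setT (fun x => f x ^+ 2) + s^-1)%:E)%E.
Proof.
move=> s0 /Lfun2P[mf intf].
have int2 : P.-integrable setT (EFin \o (fun x => s * f x ^+ 2 + s^-1)).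
  have h1 := finite_measure_integrable_cst P s^-1 measurableT.
  exact (integrableD measurableT (integrableZl measurableT s intf) h1).
apply: (@le_trans _ _ (\int[P]_x (s * f x ^+ 2 + s^-1)%:E)%E).
  apply: ge0_le_integral => //.
  - by apply/measurable_EFinP; exact: measurableT_comp.
  - exact: measurable_int int2.
  move=> x _; rewrite lee_fin -[leLHS](mulKf (lt0r_neq0 s0)) ler_pdivrMl//.
  rewrite mulrDr divff ?gt_eqF// mulrA -expr2 -(real_normK (num_real (f x))) -exprMn.
  have : 0 <= s * `|f x| by rewrite mulr_ge0// ltW.
  by move: (s * _) => z; nra.
rewrite -[leLHS]fineK; last exact: integrable_fin_num.
rewrite lee_fin -/(Rintegral P setT _) RintegralD//; first last.
- exact: finite_measure_integrable_cst.
- exact (integrableZl measurableT s intf).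
rewrite RintegralZl// lerD2l /Rintegral integral_cst//= probability_setT mule1//.
Qed.

Lemma Lfun2_lin a f g : f \in Lfun P 2%:E -> g \in Lfun P 2%:E ->
  (fun x => a * f x + g x) \in Lfun P 2%:E.
Proof. by have [_] := Lfun_submod_closed P (@lee1n R 2); apply. Qed.

Lemma Lfun2B f g : f \in Lfun P 2%:E -> g \in Lfun P 2%:E ->
  (fun x => f x - g x) \in Lfun P 2%:E.
Proof.
move=> fL gL; rewrite (_ : (fun _ => _) = (fun x => -1 * g x + f x)).
  exact: Lfun2_lin.
by apply/funext => x; ring.
Qed.

Lemma geom_half_eseries_fin :
  (\sum_(0 <= k <oo) (2 * (2^-1 ^+ k) : R)%:E < +oo)%E.
Proof.
have cg : cvgn (series (geometric (2 : R) 2^-1)).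
  by apply: is_cvg_geometric_series; rewrite ger0_norm ?invf_lt1//; lra.
rewrite (_ : (\sum_(0 <= k <oo) _)%E = (limn (series (geometric (2 : R) 2^-1)))%:E).
  exact: ltry.
rewrite -EFin_lim//; congr (limn _).
by apply/funext => n /=; rewrite /series /= sumEFin.
Qed.

(** The Riesz-Fischer argument: a subsequence whose increments have second moment
    below [4 ^- k] has increments summable in mean, hence converges almost
    surely, and Fatou's lemma bounds the distance from the sequence to the
    limit. The limit is taken as an upper limit so that it is measurable on the
    whole space. *)
Lemma Lfun2_complete (f_ : nat -> T -> R) :
  (forall n, f_ n \in Lfun P 2%:E) ->
  (forall e : R, 0 < e -> exists N, forall m n, (N <= m)%N -> (N <= n)%N ->
     Rintegral P setT (fun x => (f_ m x - f_ n x) ^+ 2) < e) ->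
  exists2 g, g \in Lfun P 2%:E & forall e : R, 0 < e -> exists N, forall n,
    (N <= n)%N -> Rintegral P setT (fun x => (f_ n x - g x) ^+ 2) <= e.
Proof.
move: f_ => f fL cf.
have /choice[N HN] : forall k : nat, exists N, forall m n, (N <= m)%N -> (N <= n)%N ->
     Rintegral P setT (fun x => (f m x - f n x) ^+ 2) < ((2^-1 ^+ k) ^+ 2).
  by move=> k; apply: cf; rewrite !exprn_gt0// invr_gt0.
(* the maximum puts [phi k] beyond [N i] for all [i <= k] at once *)
pose phi k := (\max_(i < k.+1) N i)%N.
have phiN k i : (i <= k)%N -> (N i <= phi k)%N.
  by move=> ik; rewrite /phi; exact: (leq_bigmax (Ordinal (ik : (i < k.+1)%N))).
pose u k := f (phi k).
have mfn n : measurable_fun setT (f n) by have /Lfun2P[] := fL n.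
have subL m n : (fun x => f m x - f n x) \in Lfun P 2%:E.
  exact: Lfun2B.
have intB m n := (Lfun2P _).1 (subL m n).
have mB (a b : T -> R) : measurable_fun setT a -> measurable_fun setT b ->
  measurable_fun setT (fun x => a x - b x).
  by move=> ma mb; exact (measurable_funB ma mb).
have cvu : {ae P, forall x, cvgn (fun k => u k x)}.
  have mh k : measurable_fun setT (fun x => `|u k.+1 x - u k x|%:E).
    have mh := mB _ _ (mfn (phi k.+1)) (mfn (phi k)).
    by apply/measurable_EFinP; exact: (measurableT_comp _ mh).
  have Hh : (\int[P]_x (\sum_(0 <= k <oo) `|u k.+1 x - u k x|%:E) < +oo)%E.
    rewrite integral_nneseries//.
    apply: (le_lt_trans _ geom_half_eseries_fin).
    apply: lee_nneseries => [k _ _|k _ ].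
      by apply: integral_ge0 => x _; rewrite lee_fin.
    (* [s = 2 ^+ k] balances the two terms: both become [2 ^- k] *)
    have s0 : (0 : R) < 2 ^+ k by rewrite exprn_gt0.
    apply: (le_trans (integral_norm_le_sqr s0 (subL _ _))).
    have := HN k (phi k.+1) (phi k) (phiN _ _ (leqnSn k)) (phiN _ _ (leqnn k)).
    move: (Rintegral _ _ _) => I /ltW HI; rewrite lee_fin exprVn.
    rewrite (_ : 2 * _ = 2 ^+ k * (2 ^- k) ^+ 2 + 2 ^- k); last first.
      by rewrite expr2 mulrA mulfV ?mul1r ?expf_neq0//; lra.
    by rewrite lerD2r ler_pM2l// -exprVn.
  have : {ae P, forall x, setT x ->
      ((\sum_(0 <= k <oo) `|u k.+1 x - u k x|%:E)%E \is a fin_num)}.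
    apply: integrable_ae => //; apply/integrableP; split.
      exact: ge0_emeasurable_sum.
    apply: le_lt_trans Hh; rewrite le_eqVlt; apply/orP; left; apply/eqP.
    by apply: eq_integral => x _; rewrite gee0_abs// nneseries_ge0.
  apply: filterS => x /(_ I) xfin.
  have cs : cvgn (series (telescope (fun k => u k x))).
    apply: normed_cvg; apply: nnseries_is_cvg => [k|]; first exact: normr_ge0.
    by rewrite ltey_eq xfin.
  rewrite (_ : (fun k => u k x) =
    (fun k => u 0%N x + series (telescope (fun k => u k x)) k)).
    by apply: is_cvgD => //; exact: is_cvg_cst.
  by apply/funext => k; rewrite -eq_sum_telescope.
pose g x := fine (limn_esup (fun k => (u k x)%:E)).
have mg : measurable_fun setT g.
  apply: (measurableT_comp (fine_measurable _)) => //.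
  apply: (measurable_fun_limn_esup (f := fun k x => (u k x)%:E)) => k.
  exact/measurable_EFinP/mfn.
have gE x : cvgn (fun k => u k x) -> (fun k => u k x) @ \oo --> g x.
  move=> cx; rewrite /g is_cvg_limn_esupE; last first.
    apply/cvg_ex; case/cvg_ex: cx => l cl; exists l%:E.
    by apply/fine_cvgP; split; first exact: nearW.
  by rewrite EFin_lim.
have key k0 n : (N k0 <= n)%N ->
  (\int[P]_x ((f n x - g x) ^+ 2)%:E <= ((2^-1 ^+ k0) ^+ 2)%:E)%E.
  move=> Nn.
  (* shifting by [k0] makes every term, not only almost all, satisfy the bound *)
  pose F k x : \bar R := ((f n x - u (k + k0)%N x) ^+ 2)%:E.
  have mF k : measurable_fun setT (F k).
    by apply/measurable_EFinP; apply: measurable_funX; apply: mB => //; exact: mfn.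
  have F0 k x : (0 <= F k x)%E by rewrite lee_fin sqr_ge0.
  apply: (@le_trans _ _ (\int[P]_x limn_einf (F ^~ x))%E); last first.
    apply: (le_trans (fatou P measurableT mF (fun k x _ => F0 k x))).
    rewrite limn_einf_lim; apply: lime_le; first exact: is_cvg_einfs.
    apply: nearW => k.
    apply: (@le_trans _ _ (\int[P]_x F k x)%E).
      by apply: ereal_inf_lbound; exists k => //=.
    have := HN k0 n (phi (k + k0)%N) Nn (phiN _ _ (leq_addl _ _)).
    rewrite -lte_fin /Rintegral fineK; first by move/ltW.
    apply: integrable_fin_num => //; exact: (intB _ _).2.
  rewrite le_eqVlt; apply/orP; left; apply/eqP.
  apply: ge0_ae_eq_integral => //.
  - by apply/measurable_EFinP; apply: measurable_funX; apply: mB => //; exact: mfn.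
  - (* a lower limit is minus the upper limit of the opposite *)
    rewrite /limn_einf; apply: measurableT_comp => //.
    apply: (measurable_fun_limn_esup (f := fun k x => (- F k x)%E)) => k.
    exact: measurableT_comp.
  - by move=> x _; rewrite lee_fin sqr_ge0.
  - move=> x _; rewrite limn_einf_lim; apply: lime_ge; first exact: is_cvg_einfs.
    by apply: nearW => k; apply: le_ereal_inf_tmp => _ [m _ <-]; exact: F0.
  apply: filterS cvu => x /gE ux _.
  have cF : F ^~ x @ \oo --> ((f n x - g x) ^+ 2)%:E.
    apply: cvg_EFin; first exact: nearW.
    have cB : f n x - u (k + k0)%N x @[k --> \oo] --> f n x - g x.
      apply: cvgB; first exact: cvg_cst.
      by have := ux; rewrite -(cvg_shiftn k0 (fun k => u k x)).
    by rewrite expr2; exact: (cvgM cB cB).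
  rewrite is_cvg_limn_einfE; first exact/esym/cvg_lim.
  by apply/cvg_ex; eexists; exact: cF.
have gL : g \in Lfun P 2%:E.
  have h : (fun x => f (N 0) x - g x) \in Lfun P 2%:E.
    apply/Lfun2P; split; first by apply: mB => //; exact: mfn.
    apply/integrableP; split.
      by apply/measurable_EFinP; apply: measurable_funX; apply: mB => //; exact: mfn.
    under eq_integral do rewrite gee0_abs ?lee_fin ?sqr_ge0//.
    by apply: le_lt_trans (key 0 _ (leqnn _)) _; rewrite ltry.
  rewrite (_ : g = (fun x => f (N 0) x - (f (N 0) x - g x))); last first.
    by apply/funext => x; ring.
  exact: Lfun2B.
exists g => // e e0.
have [k0 /ltW ke] : exists k, (2^-1 ^+ k) ^+ 2 < e.
  exists (Num.bound e^-1); set k := Num.bound _.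
  have ek : e^-1 < 2 ^+ k.
    apply: (lt_trans (archi_boundP _)); first by rewrite invr_ge0 ltW.
    by rewrite -natrX ltr_nat ltn_expl.
  have p1 : (2^-1 ^+ k : R) <= 1 by rewrite exprn_ile1 ?invr_ge0// invf_le1//; lra.
  apply: (@le_lt_trans _ _ (2^-1 ^+ k)).
    by rewrite expr2 ler_piMr// exprn_ge0// invr_ge0.
  by rewrite exprVn -[e]invrK ltf_pV2// posrE ?exprn_gt0// invr_gt0.
exists (N k0) => n /key kn; apply: le_trans ke.
rewrite -lee_fin /Rintegral fineK//.
rewrite ge0_fin_numE ?(le_lt_trans kn) ?ltry// integral_ge0// => x _.
by rewrite lee_fin sqr_ge0.
Qed.
End RieszFischer.

(** * Complex integrals *)
Section ComplexIntegralTheory.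
Context d (T : measurableType d) (R : realType) (mu : {measure set T -> \bar R}).
Implicit Types (g h : T -> R[i]) (c : R[i]).

Lemma cReD (x y : R[i]) : complex.Re (x + y) = complex.Re x + complex.Re y.
Proof. by case: x y => ? ? []. Qed.

Lemma cImD (x y : R[i]) : complex.Im (x + y) = complex.Im x + complex.Im y.
Proof. by case: x y => ? ? []. Qed.

Lemma cReM (x y : R[i]) : complex.Re (x * y) =
  complex.Re x * complex.Re y - complex.Im x * complex.Im y.
Proof. by case: x y => ? ? []. Qed.

Lemma cImM (x y : R[i]) : complex.Im (x * y) =
  complex.Re x * complex.Im y + complex.Im x * complex.Re y.
Proof. by case: x y => ? ? []. Qed.

Lemma cRe_conjc (x : R[i]) : complex.Re (conjc x) = complex.Re x.
Proof. by case: x. Qed.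

Lemma cIm_conjc (x : R[i]) : complex.Im (conjc x) = - complex.Im x.
Proof. by case: x. Qed.

Lemma complex_ReIm_inj (x y : R[i]) :
  complex.Re x = complex.Re y -> complex.Im x = complex.Im y -> x = y.
Proof. by case: x y => ? ? [? ?] /= -> ->. Qed.

Let lin_intg (a b : R) (u v : T -> R) :
  mu.-integrable setT (EFin \o u) -> mu.-integrable setT (EFin \o v) ->
  mu.-integrable setT (EFin \o (fun x => a * u x + b * v x)).
Proof.
move=> iu iv.
exact (integrableD measurableT (integrableZl measurableT a iu)
  (integrableZl measurableT b iv)).
Qed.

Let lin_int (a b : R) (u v : T -> R) :
  mu.-integrable setT (EFin \o u) -> mu.-integrable setT (EFin \o v) ->
  Rintegral mu setT (fun x => a * u x + b * v x) =
  a * Rintegral mu setT u + b * Rintegral mu setT v.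
Proof.
move=> iu iv; rewrite RintegralD//.
- by rewrite !RintegralZl.
- exact (integrableZl measurableT a iu).
- exact (integrableZl measurableT b iv).
Qed.

Lemma cintegrable_lin c g h : cintegrable mu g -> cintegrable mu h ->
  cintegrable mu (fun x => c * g x + h x).
Proof.
move=> [g1 g2] [h1 h2]; split.
- have := lin_intg 1 1 (lin_intg (complex.Re c) (- complex.Im c) g1 g2) h1.
  apply: eq_integrable => // x _ /=.
  by rewrite cReD cReM; congr EFin; ring.
- have := lin_intg 1 1 (lin_intg (complex.Re c) (complex.Im c) g2 g1) h2.
  apply: eq_integrable => // x _ /=.
  by rewrite cImD cImM; congr EFin; ring.
Qed.

Lemma cintegral_lin c g h : cintegrable mu g -> cintegrable mu h ->
  cintegral mu (fun x => c * g x + h x) = c * cintegral mu g + cintegral mu h.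
Proof.
move=> [g1 g2] [h1 h2]; apply: complex_ReIm_inj => /=.
- rewrite cReD cReM /=.
  rewrite (_ : Rintegral _ _ _ = Rintegral mu setT (fun x =>
      1 * (complex.Re c * complex.Re (g x) + (- complex.Im c) * complex.Im (g x)) +
      1 * complex.Re (h x))).
    by rewrite !lin_int//; [ring|exact: lin_intg].
  by apply: eq_Rintegral => x _; rewrite cReD cReM; ring.
- rewrite cImD cImM /=.
  rewrite (_ : Rintegral _ _ _ = Rintegral mu setT (fun x =>
      1 * (complex.Re c * complex.Im (g x) + complex.Im c * complex.Re (g x)) +
      1 * complex.Im (h x))).
    by rewrite !lin_int//; [ring|exact: lin_intg].
  by apply: eq_Rintegral => x _; rewrite cImD cImM; ring.
Qed.

Lemma cintegrable0 : cintegrable mu (fun=> 0).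
Proof. by split; exact: integrable0. Qed.

Lemma cintegral0 : cintegral mu (fun=> 0) = 0.
Proof. by apply: complex_ReIm_inj; rewrite /= /Rintegral integral0. Qed.

Lemma cintegrable_sum (I : Type) (r : seq I) (c : I -> R[i]) (g : I -> T -> R[i]) :
  (forall i, cintegrable mu (g i)) ->
  cintegrable mu (fun x => \sum_(i <- r) c i * g i x).
Proof.
move=> ig; elim: r => [|i r IH].
  by under eq_fun do rewrite big_nil; exact: cintegrable0.
by under eq_fun do rewrite big_cons; exact: cintegrable_lin.
Qed.

Lemma cintegral_sum (I : Type) (r : seq I) (c : I -> R[i]) (g : I -> T -> R[i]) :
  (forall i, cintegrable mu (g i)) ->
  cintegral mu (fun x => \sum_(i <- r) c i * g i x) =
  \sum_(i <- r) c i * cintegral mu (g i).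
Proof.
move=> ig; elim: r => [|i r IH].
  by under eq_fun do rewrite big_nil; rewrite big_nil cintegral0.
under eq_fun do rewrite big_cons.
by rewrite cintegral_lin ?IH ?big_cons//; exact: cintegrable_sum.
Qed.

End ComplexIntegralTheory.

(** * The space of square-integrable complex random variables *)
Section L2Theory.
Context d (T : measurableType d) (R : realType) (P : probability T R).
Implicit Types (X Y Z W : T -> R[i]) (L : set (T -> R[i])).
Local Notation L2 := (L2 P).
Local Notation inner := (inner P).
Local Notation msnorm := (msnorm P).

Lemma L2_lin (c : R[i]) X Y : L2 X -> L2 Y -> L2 (fun w => c * X w + Y w).
Proof.
move=> [X1 X2] [Y1 Y2]; split.
- rewrite (_ : (fun _ => _) = (fun w => complex.Re c * complex.Re (X w) +
    (- complex.Im c * complex.Im (X w) + complex.Re (Y w)))).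
    by apply: Lfun2_lin => //; exact: Lfun2_lin.
  by apply/funext => w; rewrite cReD cReM; ring.
- rewrite (_ : (fun _ => _) = (fun w => complex.Re c * complex.Im (X w) +
    (complex.Im c * complex.Re (X w) + complex.Im (Y w)))).
    by apply: Lfun2_lin => //; exact: Lfun2_lin.
  by apply/funext => w; rewrite cImD cImM; ring.
Qed.

Lemma L2_0 : L2 (cst 0).
Proof. by split; exact: (Lfun_cst P 0). Qed.

Lemma L2Z (c : R[i]) X : L2 X -> L2 (fun w => c * X w).
Proof.
move=> LX; rewrite (_ : (fun _ => _) = (fun w => c * X w + cst 0 w)).
  exact: L2_lin L2_0.
by apply/funext => w; rewrite addr0.
Qed.

Lemma L2D X Y : L2 X -> L2 Y -> L2 (X \+ Y).
Proof.
move=> LX LY; rewrite (_ : X \+ Y = (fun w => 1 * X w + Y w)).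
  exact: L2_lin.
by apply/funext => w; rewrite mul1r.
Qed.

Lemma L2B X Y : L2 X -> L2 Y -> L2 (X \- Y).
Proof.
move=> LX LY; rewrite (_ : X \- Y = (fun w => (-1) * Y w + X w)).
  exact: L2_lin.
by apply/funext => w; rewrite mulN1r addrC.
Qed.

Lemma L2_sum (I : Type) (r : seq I) (c : I -> R[i]) (g : I -> T -> R[i]) :
  (forall i, L2 (g i)) -> L2 (fun w => \sum_(i <- r) c i * g i w).
Proof.
move=> Lg; elim: r => [|i r IH].
  by under eq_fun do rewrite big_nil; exact: L2_0.
by under eq_fun do rewrite big_cons; exact: L2_lin.
Qed.

Lemma L2_mul_cintegrable X Y : L2 X -> L2 Y ->
  cintegrable P (fun w => X w * conjc (Y w)).
Proof.
move=> [X1 X2] [Y1 Y2].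
have mi u v : u \in Lfun P 2%:E -> v \in Lfun P 2%:E ->
    P.-integrable setT (EFin \o (fun x => u x * v x)).
  by move=> uL vL; apply/Lfun1_integrable; exact: Lfun2_mul_Lfun1.
split.
- have := integrableD measurableT (mi _ _ X1 Y1) (mi _ _ X2 Y2).
  apply: eq_integrable => // w _ /=.
  by rewrite cReM cRe_conjc cIm_conjc -EFinD; congr EFin; ring.
- have := integrableB measurableT (mi _ _ X2 Y1) (mi _ _ X1 Y2).
  apply: eq_integrable => // w _ /=.
  by rewrite cImM cRe_conjc cIm_conjc -EFinB; congr EFin; ring.
Qed.

Lemma inner_linl (c : R[i]) X Y Z : L2 X -> L2 Y -> L2 Z ->
  inner (fun w => c * X w + Y w) Z = c * inner X Z + inner Y Z.
Proof.
move=> LX LY LZ; rewrite /inner /cexpect -cintegral_lin//; first last.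
- exact: L2_mul_cintegrable.
- exact: L2_mul_cintegrable.
by congr cintegral; apply/funext => w; ring.
Qed.

Lemma inner0l Z : inner (cst 0) Z = 0.
Proof.
rewrite /inner /cexpect -[RHS](cintegral0 P); congr cintegral.
by apply/funext => w; rewrite mul0r.
Qed.

Lemma innerZl (c : R[i]) X Z : L2 X -> L2 Z ->
  inner (fun w => c * X w) Z = c * inner X Z.
Proof.
move=> LX LZ; rewrite -[RHS]addr0 -(inner0l Z) -inner_linl//; last exact: L2_0.
by congr inner; apply/funext => w; rewrite addr0.
Qed.

Lemma innerDl X Y Z : L2 X -> L2 Y -> L2 Z ->
  inner (X \+ Y) Z = inner X Z + inner Y Z.
Proof.
move=> LX LY LZ; rewrite -[inner X Z]mul1r -inner_linl//.
by congr inner; apply/funext => w; rewrite mul1r.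
Qed.

Lemma innerBl X Y Z : L2 X -> L2 Y -> L2 Z ->
  inner (X \- Y) Z = inner X Z - inner Y Z.
Proof.
move=> LX LY LZ; rewrite addrC -mulN1r -inner_linl//.
by congr inner; apply/funext => w; rewrite mulN1r addrC.
Qed.

Lemma innerBr X Y Z : L2 X -> L2 Y -> L2 Z ->
  inner Z (X \- Y) = inner Z X - inner Z Y.
Proof.
move=> LX LY LZ.
by rewrite innerC innerBl// (innerC P X Z) (innerC P Y Z); exact: rmorphB.
Qed.

Lemma innerZr (c : R[i]) X Z : L2 X -> L2 Z ->
  inner Z (fun w => c * X w) = conjc c * inner Z X.
Proof.
by move=> LX LZ; rewrite innerC innerZl// (innerC P X Z); exact: rmorphM.
Qed.

(** The real part of the inner product is a real semi-inner product; it is used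
    because it makes the minimisation arguments below one-dimensional. *)
Definition re_inner X Y : R := complex.Re (inner X Y).

Definition sqnorm X : R := re_inner X X.

Lemma re_innerC X Y : re_inner X Y = re_inner Y X.
Proof. by rewrite /re_inner innerC cRe_conjc. Qed.

Lemma re_inner_linl (t : R) X Y Z : L2 X -> L2 Y -> L2 Z ->
  re_inner (fun w => t%:C * X w + Y w) Z = t * re_inner X Z + re_inner Y Z.
Proof. by move=> *; rewrite /re_inner inner_linl// cReD cReM /= mul0r subr0. Qed.

Lemma re_innerZl (t : R) X Z : L2 X -> L2 Z ->
  re_inner (fun w => t%:C * X w) Z = t * re_inner X Z.
Proof. by move=> *; rewrite /re_inner innerZl// cReM /= mul0r subr0. Qed.

Lemma re_innerDl X Y Z : L2 X -> L2 Y -> L2 Z ->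
  re_inner (X \+ Y) Z = re_inner X Z + re_inner Y Z.
Proof. by move=> *; rewrite /re_inner innerDl// cReD. Qed.

Lemma re_innerBl X Y Z : L2 X -> L2 Y -> L2 Z ->
  re_inner (X \- Y) Z = re_inner X Z - re_inner Y Z.
Proof. by move=> *; rewrite /re_inner innerBl//. Qed.

Lemma sqnorm_lin (t : R) X Y : L2 X -> L2 Y ->
  sqnorm (fun w => t%:C * X w + Y w) =
    t ^+ 2 * sqnorm X + 2 * t * re_inner X Y + sqnorm Y.
Proof.
move=> LX LY; rewrite /sqnorm re_inner_linl//; last exact: L2_lin.
pose Z w := t%:C * X w + Y w; have LZ : L2 Z by exact: L2_lin.
by rewrite (re_innerC X Z) (re_innerC Y Z) !re_inner_linl// (re_innerC Y X); ring.
Qed.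

Lemma sqnormB X Y : L2 X -> L2 Y ->
  sqnorm (X \- Y) = sqnorm X - 2 * re_inner X Y + sqnorm Y.
Proof.
move=> LX LY; rewrite (_ : X \- Y = (fun w => (-1)%:C * Y w + X w)).
  by rewrite sqnorm_lin// re_innerC; ring.
by apply/funext => w; rewrite rmorphN mulN1r addrC.
Qed.

Lemma sqnormD X Y : L2 X -> L2 Y ->
  sqnorm (X \+ Y) = sqnorm X + 2 * re_inner X Y + sqnorm Y.
Proof.
move=> LX LY; rewrite (_ : X \+ Y = (fun w => 1%:C * X w + Y w)).
  by rewrite sqnorm_lin//; ring.
by apply/funext => w; rewrite rmorph1 mul1r.
Qed.

Lemma sqnormE X : L2 X ->
  sqnorm X = Rintegral P setT (fun w => complex.Re (X w) ^+ 2) +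
  Rintegral P setT (fun w => complex.Im (X w) ^+ 2).
Proof.
move=> [/Lfun2P[_ X1] /Lfun2P[_ X2]]; rewrite -RintegralD//.
by apply: eq_Rintegral => w _; rewrite cReM cRe_conjc cIm_conjc; ring.
Qed.

Lemma sqnorm_ge0 X : 0 <= sqnorm X.
Proof.
apply: Rintegral_ge0 => w _; rewrite cReM cRe_conjc cIm_conjc mulrN opprK.
by rewrite addr_ge0// -expr2 sqr_ge0.
Qed.

Lemma inner_self X : inner X X = (sqnorm X)%:C.
Proof.
apply: complex_ReIm_inj; first by [].
move: (congr1 (@complex.Im R) (innerC P X X)); rewrite cIm_conjc.
by move: (inner X X) (sqnorm X) => [a b] c /= ?; lra.
Qed.

Lemma msnorm_ge0 X : 0 <= msnorm X. Proof. exact: sqrtr_ge0. Qed.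

Lemma msnorm_sqr X : msnorm X ^+ 2 = sqnorm X.
Proof. by rewrite sqr_sqrtr// sqnorm_ge0. Qed.

Lemma msnormZ (c : R[i]) X : L2 X ->
  msnorm (fun w => c * X w) =
    Num.sqrt (complex.Re c ^+ 2 + complex.Im c ^+ 2) * msnorm X.
Proof.
move=> LX; rewrite {1}/msnorm innerZl//; last exact: L2Z.
rewrite innerZr// inner_self mulrA cReM /= mulr0 subr0.
rewrite sqrtrM; last first.
  by rewrite cReM cRe_conjc cIm_conjc mulrN opprK addr_ge0// -expr2 sqr_ge0.
by congr (Num.sqrt _ * _); rewrite cReM cRe_conjc cIm_conjc mulrN opprK -!expr2.
Qed.

(** A quadratic polynomial without negative values has a nonpositive
    discriminant. This gives the Cauchy-Schwarz inequality, and it turns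
    near-minimality of a distance into near-orthogonality. *)
Lemma discriminant_le (w r eps : R) : 0 <= w ->
  (forall t, 0 <= t ^+ 2 * w - 2 * t * r + eps) -> r ^+ 2 <= w * eps.
Proof.
move=> w0 q; move: w0; rewrite le_eqVlt => /predU1P[w0|w0].
  rewrite -w0 mul0r; have [->|r0] := eqVneq r 0; first by rewrite expr0n.
  have := q ((eps + 1) / (2 * r)).
  rewrite -w0 mulr0 add0r (_ : 2 * _ * _ = eps + 1); first by lra.
  by field.
have := q (r / w).
rewrite (_ : _ + eps = (w * eps - r ^+ 2) / w); last by field; rewrite gt_eqF.
by rewrite pmulr_lge0 ?invr_gt0// subr_ge0.
Qed.

Lemma re_inner_sqr_le X Y : L2 X -> L2 Y ->
  re_inner X Y ^+ 2 <= sqnorm X * sqnorm Y.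
Proof.
move=> LX LY; apply: discriminant_le => [|t]; first exact: sqnorm_ge0.
have -> : t ^+ 2 * sqnorm X - 2 * t * re_inner X Y + sqnorm Y =
    sqnorm (fun w => (- t)%:C * X w + Y w) by rewrite sqnorm_lin//; ring.
exact: sqnorm_ge0.
Qed.

Lemma re_inner_le X Y : L2 X -> L2 Y -> `|re_inner X Y| <= msnorm X * msnorm Y.
Proof.
move=> LX LY; rewrite -(@ler_pXn2r _ 2)// ?nnegrE ?mulr_ge0 ?msnorm_ge0//.
by rewrite exprMn !msnorm_sqr real_normK ?num_real// re_inner_sqr_le.
Qed.

Lemma msnormD X Y : L2 X -> L2 Y -> msnorm (X \+ Y) <= msnorm X + msnorm Y.
Proof.
move=> LX LY; rewrite -(@ler_pXn2r _ 2)// ?nnegrE ?addr_ge0 ?msnorm_ge0//.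
rewrite sqrrD !msnorm_sqr sqnormD//.
have := le_trans (ler_norm _) (re_inner_le LX LY); lra.
Qed.

Lemma msnorm_distC X Y : L2 X -> L2 Y -> msnorm (X \- Y) = msnorm (Y \- X).
Proof.
move=> LX LY; congr Num.sqrt; rewrite -[LHS]/(sqnorm _) -[RHS]/(sqnorm _) !sqnormB//.
by rewrite re_innerC; ring.
Qed.

Lemma msnorm_triangle Z X Y : L2 X -> L2 Y -> L2 Z ->
  msnorm (X \- Y) <= msnorm (X \- Z) + msnorm (Z \- Y).
Proof.
move=> LX LY LZ; rewrite (_ : X \- Y = (X \- Z) \+ (Z \- Y)).
  by apply: msnormD; exact: L2B.
by apply/funext => w /=; rewrite subrKA.
Qed.

Lemma msnorm_subr_self X : msnorm (X \- X) = 0.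
Proof.
rewrite (_ : X \- X = cst 0); last by apply/funext => w; rewrite /= subrr.
by rewrite /msnorm inner0l /= sqrtr0.
Qed.

Lemma ae_eq_msnorm X Y : L2 X -> L2 Y -> {ae P, forall w, X w = Y w} ->
  msnorm (X \- Y) = 0.
Proof.
move=> LX LY XY; have [X1 X2] := L2B LX LY.
suff r0 (u : T -> R) : u \in Lfun P 2%:E -> {ae P, forall w, u w = 0} ->
    Rintegral P setT (fun w => u w ^+ 2) = 0.
  suff: msnorm (X \- Y) ^+ 2 = 0 by move/eqP; rewrite sqrf_eq0 => /eqP.
  rewrite msnorm_sqr sqnormE; last exact: L2B.
  by rewrite !r0 ?addr0//; apply: filterS XY => w /= ->; rewrite subrr.
move=> /Lfun2P[_ /measurable_int mu2] u0.
rewrite /Rintegral (_ : integral _ _ _ = 0%E)//.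
rewrite (@ge0_ae_eq_integral _ _ _ P setT _ (cst 0%E)) ?integral0//.
- by move=> w _; rewrite lee_fin sqr_ge0.
- by apply: filterS u0 => w /= -> _; rewrite expr0n.
Qed.

(** Complex orthogonality can be tested on real parts, because the real part of
    the inner product with [i Y] is the imaginary part of that with [Y]. *)
Lemma inner_eq0 X Y : L2 X -> L2 Y ->
  re_inner X Y = 0 -> re_inner X (fun w => 'i * Y w) = 0 -> inner X Y = 0.
Proof.
move=> LX LY r1; rewrite /re_inner innerZr// cReM /= => r2.
apply: complex_ReIm_inj => //=; lra.
Qed.

Lemma inner_null X W : L2 X -> L2 W -> msnorm X = 0 -> inner X W = 0.
Proof.
move=> LX LW X0.
have r0 U : L2 U -> re_inner X U = 0.
  move=> LU; apply/eqP; rewrite -normr_le0; apply: (le_trans (re_inner_le LX LU)).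
  by rewrite X0 mul0r.
by apply: inner_eq0 => //; apply: r0 => //; exact: L2Z.
Qed.

(** The real and imaginary parts converge separately, the squared norm being the
    sum of theirs. *)
Lemma L2_complete (X_ : nat -> T -> R[i]) : (forall n, L2 (X_ n)) ->
  (forall e : R, 0 < e -> exists N, forall m n, (N <= m)%N -> (N <= n)%N ->
     sqnorm (X_ m \- X_ n) < e) ->
  exists2 X, L2 X & forall e : R, 0 < e -> exists N, forall n,
    (N <= n)%N -> sqnorm (X_ n \- X) <= e.
Proof.
move=> LX cX.
have ReB (x y : R[i]) : complex.Re (x - y) = complex.Re x - complex.Re y.
  by case: x y => ? ? [].
have ImB (x y : R[i]) : complex.Im (x - y) = complex.Im x - complex.Im y.
  by case: x y => ? ? [].
have sq0 (u : T -> R) : 0 <= Rintegral P setT (fun w => u w ^+ 2).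
  by apply: Rintegral_ge0 => w _; exact: sqr_ge0.
have nE Y Z : L2 Y -> L2 Z -> sqnorm (Y \- Z) =
    Rintegral P setT (fun w => (complex.Re (Y w) - complex.Re (Z w)) ^+ 2) +
    Rintegral P setT (fun w => (complex.Im (Y w) - complex.Im (Z w)) ^+ 2).
  move=> LY LZ; rewrite sqnormE; last exact: L2B.
  by congr (_ + _); apply: eq_Rintegral => w _ /=; rewrite ?ReB ?ImB.
have [|u Lu Hu] := @Lfun2_complete _ _ _ P
    (fun n w => complex.Re (X_ n w)) (fun n => (LX n).1).
  move=> e /cX[N HN]; exists N => m n Nm Nn; apply: le_lt_trans (HN _ _ Nm Nn).
  by rewrite nE// lerDl.
have [|v Lv Hv] := @Lfun2_complete _ _ _ P
    (fun n w => complex.Im (X_ n w)) (fun n => (LX n).2).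
  move=> e /cX[N HN]; exists N => m n Nm Nn; apply: le_lt_trans (HN _ _ Nm Nn).
  by rewrite nE// lerDr.
have Luv : L2 (fun w => u w +i* v w) by [].
exists (fun w => u w +i* v w) => // e e0.
have e20 : 0 < e / 2 by rewrite divr_gt0.
have [N1 H1] := Hu _ e20; have [N2 H2] := Hv _ e20.
exists (maxn N1 N2) => n; rewrite geq_max => /andP[n1 n2].
by rewrite nE//= [e]splitr lerD// ?H1// H2.
Qed.

End L2Theory.

(** * Closed subspaces and projections *)
Section ClosedSubspaces.
Context d (T : measurableType d) (R : realType) (P : probability T R).
Implicit Types (X Y Z W : T -> R[i]) (L G : set (T -> R[i])).
Local Notation L2 := (L2 P).
Local Notation inner := (inner P).
Local Notation msnorm := (msnorm P).
Local Notation re_inner := (re_inner P).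
Local Notation sqnorm := (sqnorm P).
Local Notation is_proj := (is_proj P).
Local Notation proj := (Defs.proj P).

Record closed_subspace L : Prop := ClosedSubspace {
  csub_L2 : forall X, L X -> L2 X;
  csub_0 : L (cst 0);
  csub_lin : forall (c : R[i]) X Y, L X -> L Y -> L (fun w => c * X w + Y w);
  csub_closed : forall X, L2 X ->
    (forall e : R, 0 < e -> exists2 Z, L Z & msnorm (X \- Z) < e) -> L X }.

Lemma csubZ L (c : R[i]) X : closed_subspace L -> L X -> L (fun w => c * X w).
Proof.
move=> cL LX; rewrite (_ : (fun _ => _) = (fun w => c * X w + cst 0 w)).
  by apply: csub_lin => //; exact: csub_0.
by apply/funext => w; rewrite addr0.
Qed.

Lemma csubB L X Y : closed_subspace L -> L X -> L Y -> L (X \- Y).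
Proof.
move=> cL LX LY; rewrite (_ : X \- Y = (fun w => (-1) * Y w + X w)).
  exact: csub_lin.
by apply/funext => w; rewrite mulN1r addrC.
Qed.

Lemma csubD L X Y : closed_subspace L -> L X -> L Y -> L (X \+ Y).
Proof.
move=> cL LX LY; rewrite (_ : X \+ Y = (fun w => 1 * X w + Y w)).
  exact: csub_lin.
by apply/funext => w; rewrite mul1r.
Qed.

(** Membership in a closed subspace only depends on the class in [L^2]. *)
Lemma csub_null L X Y : closed_subspace L -> L X -> L2 Y ->
  msnorm (Y \- X) = 0 -> L Y.
Proof.
by move=> cL LX LY XY; apply: (csub_closed cL) => // e e0; exists X; rewrite ?XY.
Qed.

(** The parallelogram identity for [X - Y] and [X - Z]. *)
Lemma sqnorm_half_sum X Y Z : L2 X -> L2 Y -> L2 Z ->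
  sqnorm (Y \- Z) = 2 * sqnorm (X \- Y) + 2 * sqnorm (X \- Z) -
    4 * sqnorm (X \- (fun w => (2^-1)%:C * (Y \+ Z) w)).
Proof.
move=> LX LY LZ; rewrite !sqnormB//; last by apply: L2Z; exact: L2D.
have LS := L2D LY LZ.
have LH := L2Z (2^-1)%:C LS; set H := fun w => _ in LH *.
have r1 : re_inner X H = 2^-1 * re_inner (Y \+ Z) X by rewrite re_innerC re_innerZl.
have r2 : sqnorm H = 2^-1 * (2^-1 * sqnorm (Y \+ Z)).
  by rewrite /sqnorm re_innerZl// re_innerC re_innerZl.
by rewrite r1 r2 sqnormD// re_innerDl// (re_innerC P Y X) (re_innerC P Z X); field.
Qed.

(** A sequence in [L] minimising the distance to [X] is Cauchy by the
    parallelogram identity. Its residuals are nearly orthogonal to [L], and this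
    passes to the limit. *)
Lemma is_proj_exists L X : closed_subspace L -> L2 X -> exists Z, is_proj L X Z.
Proof.
move=> cL LX.
pose D := [set sqnorm (X \- Z) | Z in L].
have D0 : D !=set0 by exists (sqnorm (X \- cst 0)), (cst 0) => //; exact: csub_0.
have lbD : has_lbound D by exists 0 => _ [Z _ <-]; exact: sqnorm_ge0.
have infD : has_inf D by split.
have dle Z : L Z -> inf D <= sqnorm (X \- Z).
  by move=> LZ; apply: ge_inf => //; exists Z.
have /choice[Z_ HZ] : forall n : nat, exists Z,
    L Z /\ sqnorm (X \- Z) < inf D + n.+1%:R^-1.
  move=> n; have [|_ [Z LZ <-] HZ] := inf_adherent (eps := n.+1%:R^-1) _ infD.
    by rewrite invr_gt0.
  by exists Z.
have LZ n := (HZ n).1; have L2Z n := csub_L2 cL (LZ n).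
have inv_small (e : R) : 0 < e -> exists N, forall n, (N <= n)%N -> n.+1%:R^-1 < e.
  move=> e0; exists (Num.bound e^-1) => n Nn; rewrite invf_plt ?posrE//.
  have ei : 0 <= e^-1 by rewrite invr_ge0 ltW.
  apply: (lt_le_trans (archi_boundP ei)); rewrite ler_nat; exact: leqW.
have [|Z L2Zl HZl] := L2_complete L2Z.
  move=> e e0; have [|N HN] := inv_small (e / 4); first by rewrite divr_gt0.
  exists N => m n Nm Nn; rewrite (sqnorm_half_sum LX)//.
  have Lh : L (fun w => (2^-1)%:C * (Z_ m \+ Z_ n) w).
    by apply: csubZ => //; apply: csubD.
  have := dle _ Lh; have := (HZ m).2; have := (HZ n).2.
  have := HN m Nm; have := HN n Nn.
  by move: (n.+1%:R^-1 : R) (m.+1%:R^-1 : R) => a b *; lra.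
have LZl : L Z.
  apply: (csub_closed cL) => // e e0.
  have e2 : 0 < (e / 2) ^+ 2 by rewrite exprn_gt0 ?divr_gt0.
  have [N HN] := HZl _ e2; exists (Z_ N) => //.
  rewrite msnorm_distC//; apply: (@le_lt_trans _ _ (e / 2)); last by lra.
  rewrite -(@ler_pXn2r _ 2)// ?nnegrE ?msnorm_ge0 ?msnorm_sqr ?HN//.
  by rewrite divr_ge0// ltW.
exists Z; split => //.
have orth W : L W -> re_inner (X \- Z) W = 0.
  move=> LW; have L2W := csub_L2 cL LW.
  have bound n : re_inner (X \- Z_ n) W ^+ 2 <= sqnorm W * n.+1%:R^-1.
    apply: discriminant_le; [exact: sqnorm_ge0|move=> t].
    have Lt : L (fun w => t%:C * W w + Z_ n w) by apply: csub_lin.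
    have := dle _ Lt; rewrite (_ : X \- _ = (fun w => (- t)%:C * W w + (X \- Z_ n) w)).
      rewrite (sqnorm_lin (- t) L2W (L2B LX (L2Z n))) (re_innerC P _ W).
      have := (HZ n).2; move: (n.+1%:R^-1 : R) => b; lra.
    by apply/funext => w /=; rewrite rmorphN; ring.
  apply/eqP; rewrite -normr_le0; apply/ler_addgt0Pl => e e0; rewrite addr0.
  pose B := sqnorm W + 1.
  have B0 : 0 < B by rewrite /B ltr_wpDl ?sqnorm_ge0.
  have eB : 0 < (e / 2) ^+ 2 / B by rewrite divr_gt0// exprn_gt0// divr_gt0.
  have small r s : 0 <= s -> r ^+ 2 <= sqnorm W * s -> s <= (e / 2) ^+ 2 / B ->
      `|r| <= e / 2.
    move=> s0 rs; rewrite ler_pdivlMr// => sB.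
    rewrite -(@ler_pXn2r _ 2)// ?nnegrE ?divr_ge0 ?(ltW e0)//.
    rewrite real_normK ?num_real//; apply: (le_trans rs); apply: le_trans sB.
    by rewrite mulrC ler_wpM2l// /B lerDl.
  have [N1 H1] := inv_small _ eB; have [N2 H2] := HZl _ eB.
  pose n := maxn N1 N2.
  rewrite (_ : X \- Z = (X \- Z_ n) \+ (Z_ n \- Z)); last first.
    by apply/funext => w /=; rewrite subrKA.
  rewrite re_innerDl; [|exact: L2B..|by []].
  rewrite [e]splitr (le_trans (ler_normD _ _))// lerD//.
    by apply: small (bound n) _; rewrite ?invr_ge0// ltW// H1// leq_maxl.
  apply: (small _ (sqnorm (Z_ n \- Z))); rewrite ?sqnorm_ge0//.
    by rewrite mulrC; apply: re_inner_sqr_le => //; exact: L2B.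
  by rewrite H2// leq_maxr.
move=> W LW; apply: inner_eq0.
- exact: L2B.
- exact: (csub_L2 cL LW).
- exact: orth.
- by apply: orth; exact: csubZ.
Qed.

Lemma projP L X : closed_subspace L -> L2 X -> is_proj L X (proj L X).
Proof.
by move=> cL LX; have [Z HZ] := is_proj_exists cL LX; exact: (xgetI _ HZ).
Qed.

Lemma is_proj_id L X : L X -> is_proj L X X.
Proof.
move=> LX; split=> // W _; rewrite (_ : X \- X = cst 0) ?inner0l//.
by apply/funext => w; rewrite /= subrr.
Qed.

(** The difference [X - X'] is the sum of [Z - Z'], which lies in [L], and of a
    residual orthogonal to [L]. *)
Lemma is_proj_nonexpansive L X X' Z Z' : closed_subspace L -> L2 X -> L2 X' ->
  is_proj L X Z -> is_proj L X' Z' -> msnorm (Z \- Z') <= msnorm (X \- X').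
Proof.
move=> cL LX LX' [LZ oZ] [LZ' oZ'].
have L2Z := csub_L2 cL LZ; have L2Z' := csub_L2 cL LZ'.
rewrite -(@ler_pXn2r _ 2)// ?nnegrE ?msnorm_ge0// !msnorm_sqr.
pose D := Z \- Z'; have LD : L D by exact: csubB.
pose O := (X \- Z) \- (X' \- Z').
rewrite (_ : X \- X' = O \+ D); last first.
  by apply/funext => w; rewrite /O /D /=; ring.
have LO : L2 O by apply: L2B; exact: L2B.
rewrite (sqnormD LO (csub_L2 cL LD)).
rewrite (_ : re_inner O D = 0); first by rewrite mulr0 addr0 lerDr sqnorm_ge0.
rewrite re_innerBl; [|exact: L2B..|exact: (csub_L2 cL LD)].
by rewrite /re_inner oZ// oZ'// subrr.
Qed.

Lemma is_proj_unique L X Z Z' : closed_subspace L -> L2 X ->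
  is_proj L X Z -> is_proj L X Z' -> msnorm (Z \- Z') = 0.
Proof.
move=> cL LX pZ pZ'; apply/eqP; rewrite eq_le msnorm_ge0 andbT.
by rewrite -(msnorm_subr_self P X); exact: is_proj_nonexpansive pZ pZ'.
Qed.

Lemma is_proj_null L X Z Z' : closed_subspace L -> L2 X -> is_proj L X Z ->
  L Z' -> msnorm (Z \- Z') = 0 -> is_proj L X Z'.
Proof.
move=> cL LX [LZ oZ] LZ' ZZ'; split=> // W LW.
have L2Z := csub_L2 cL LZ; have L2Z' := csub_L2 cL LZ'; have L2W := csub_L2 cL LW.
rewrite (_ : X \- Z' = (X \- Z) \+ (Z \- Z')); last first.
  by apply/funext => w /=; rewrite subrKA.
by rewrite innerDl ?oZ// ?inner_null ?addr0//; exact: L2B.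
Qed.

(** The residual [X - Z2] is orthogonal to the larger subspace, so the projection
    onto the smaller one does not see it. *)
Lemma is_proj_tower L L' X Z1 Z2 : closed_subspace L' -> L `<=` L' ->
  L2 X -> is_proj L X Z1 -> is_proj L' X Z2 -> is_proj L Z2 Z1.
Proof.
move=> cL s12 LX [LZ1 o1] [LZ2 o2]; split=> // W LW.
have L2Z1 := csub_L2 cL (s12 _ LZ1); have L2Z2 := csub_L2 cL LZ2.
rewrite (_ : Z2 \- Z1 = (X \- Z1) \- (X \- Z2)); last first.
  by apply/funext => w /=; ring.
rewrite innerBl; [|exact: L2B..|exact: (csub_L2 cL (s12 _ LW))].
by rewrite o1// o2 ?subrr//; exact: s12.
Qed.

Lemma is_proj_sub L X Z L' : closed_subspace L -> L' `<=` L ->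
  L' Z -> is_proj L X Z -> is_proj L' X Z.
Proof. by move=> cL sL LZ [_ oZ]; split=> // W /sL; exact: oZ. Qed.

Lemma lim_ms_csub L (F : set_system R) (Z_ : R -> T -> R[i]) Z : ProperFilter F ->
  closed_subspace L -> (forall h, L (Z_ h)) -> lim_ms P F Z_ Z -> L Z.
Proof.
move=> FF cL LZ_ [LZ cZ]; apply: (csub_closed cL) => // e e0.
have /cvgr0Pnorm_lt/(_ e e0)/filter_ex[h] := cZ.
rewrite ger0_norm ?msnorm_ge0// msnorm_distC//; last exact: (csub_L2 cL (LZ_ h)).
by exists (Z_ h).
Qed.

Lemma lim_ms_unique (F : set_system R) (Z_ : R -> T -> R[i]) Z Z' :
  ProperFilter F -> (forall h, L2 (Z_ h)) -> lim_ms P F Z_ Z ->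
  lim_ms P F Z_ Z' -> msnorm (Z \- Z') = 0.
Proof.
move=> FF LZ_ [LZ cZ] [LZ' cZ'].
apply/eqP; rewrite eq_le msnorm_ge0 andbT; apply/ler_addgt0Pl => e e0.
rewrite addr0.
have e2 : 0 < e / 2 by rewrite divr_gt0.
have /cvgr0Pnorm_lt/(_ _ e2) h1 := cZ; have /cvgr0Pnorm_lt/(_ _ e2) h2 := cZ'.
have [h []] := filter_ex (filterI h1 h2).
rewrite /= !ger0_norm ?msnorm_ge0// => h1' h2'.
apply: (le_trans (msnorm_triangle LZ LZ' (LZ_ h))).
by rewrite (msnorm_distC LZ (LZ_ h)) [e]splitr lerD// ltW.
Qed.

Lemma lim_ms_dominated (F : set_system R) (Z_ Z'_ : R -> T -> R[i]) Z :
  Filter F -> lim_ms P F Z_ Z ->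
  (forall h, msnorm (Z'_ h \- Z) <= msnorm (Z_ h \- Z)) -> lim_ms P F Z'_ Z.
Proof.
move=> FF [LZ cZ] dom; split=> //; apply/cvgr0Pnorm_lt => e e0.
have /cvgr0Pnorm_lt/(_ e e0) := cZ; apply: filterS => h.
by rewrite !ger0_norm ?msnorm_ge0//; exact: le_lt_trans.
Qed.

Lemma lin_span_lin G (c : R[i]) X Y : lin_span G X -> lin_span G Y ->
  lin_span G (fun w => c * X w + Y w).
Proof.
move=> [n [a [g [Gg ->]]]] [m [b [g' [Gg' ->]]]].
exists (n + m)%N,
  (fun i => match fintype.split i with inl i => c * a i | inr i => b i end),
  (fun i => match fintype.split i with inl i => g i | inr i => g' i end); split.
  by move=> i; case: (fintype.split i).
apply/funext => w; rewrite big_split_ord mulr_sumr; congr (_ + _).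
  apply: eq_bigr => i _.
  by rewrite (_ : fintype.split (lshift m i) = inl i) ?mulrA//; exact: unsplitK (inl i).
apply: eq_bigr => i _.
by rewrite (_ : fintype.split (rshift n i) = inr i)//; exact: unsplitK (inr i).
Qed.

Lemma lin_span_L2 G X : G `<=` L2 -> lin_span G X -> L2 X.
Proof. by move=> GL [n [c [g [Gg ->]]]]; apply: L2_sum => i; exact/GL. Qed.

Lemma lin_span0 G : lin_span G (cst 0).
Proof.
exists 0%N, (fun=> 0), (fun=> cst 0); split; first by case.
by apply/funext => w; rewrite big_ord0.
Qed.

Lemma lin_span_gen G X : G X -> lin_span G X.
Proof.
move=> GX; exists 1%N, (fun=> 1), (fun=> X); split => //.
by apply/funext => w; rewrite big_ord1 mul1r.
Qed.

(** Terms with a zero coefficient may lie outside [G], so that deleting terms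
    from a linear combination does not force a change of index set. *)
Lemma lin_span_sum G (I : Type) (r : seq I) (c : I -> R[i]) (g : I -> T -> R[i]) :
  (forall i, c i = 0 \/ G (g i)) -> lin_span G (fun w => \sum_(i <- r) c i * g i w).
Proof.
move=> cg; elim: r => [|i r IH].
  by under eq_fun do rewrite big_nil; exact: lin_span0.
under eq_fun do rewrite big_cons.
case: (cg i) => [->|Gi]; last exact: lin_span_lin (lin_span_gen Gi) IH.
by under eq_fun do rewrite mul0r add0r.
Qed.

Lemma lin_spanS G G' : G `<=` G' -> lin_span G `<=` lin_span G'.
Proof. by move=> s _ [n [c [g [Gg ->]]]]; exists n, c, g; split=> // i; exact/s. Qed.

Lemma closed_lin_span_lin_span G : G `<=` L2 ->
  lin_span G `<=` closed_lin_span P G.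
Proof.
move=> GL X sX; split; first exact: lin_span_L2 sX.
by move=> e e0; exists X; rewrite ?msnorm_subr_self.
Qed.

Lemma closed_lin_spanS G G' : G `<=` G' ->
  closed_lin_span P G `<=` closed_lin_span P G'.
Proof.
move=> s X [LX H]; split=> // e /H[Z sZ ZX]; exists Z => //; exact: lin_spanS sZ.
Qed.

Lemma closed_lin_span_csub G : G `<=` L2 -> closed_subspace (closed_lin_span P G).
Proof.
move=> GL; split.
- by move=> X [].
- apply: closed_lin_span_lin_span => //; exact: lin_span0.
- move=> c X Y [LX HX] [LY HY]; split; first exact: L2_lin.
  move=> e e0; pose m := Num.sqrt (complex.Re c ^+ 2 + complex.Im c ^+ 2).
  pose M := m + 1; have c0 : 0 <= m by exact: sqrtr_ge0.
  have M0 : 0 < M by rewrite /M ltr_wpDl.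
  have [|Z sZ XZ] := HX (e / 2 / M); first by rewrite !divr_gt0.
  have [|W sW YW] := HY (e / 2); first by rewrite divr_gt0.
  exists (fun w => c * Z w + W w); first exact: lin_span_lin.
  have LXZ : L2 (X \- Z) by apply: L2B => //; exact: lin_span_L2 sZ.
  have LYW : L2 (Y \- W) by apply: L2B => //; exact: lin_span_L2 sW.
  rewrite (_ : (fun _ => _) \- _ = (fun w => c * (X \- Z) w) \+ (Y \- W)); last first.
    by apply/funext => w /=; ring.
  apply: (le_lt_trans (msnormD (L2Z c LXZ) LYW)); rewrite msnormZ// -/m [e]splitr.
  apply: ler_ltD => //; apply: (@le_trans _ _ (M * (e / 2 / M))).
    by rewrite ler_pM ?msnorm_ge0// ?lerDl// ltW.
  by rewrite mulrCA divff ?mulr1// gt_eqF.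
- move=> X LX HX; split=> // e e0.
  have e2 : 0 < e / 2 by rewrite divr_gt0.
  have [Z [LZ HZ] XZ] := HX _ e2; have [W sW ZW] := HZ _ e2.
  exists W => //; apply: (le_lt_trans (msnorm_triangle LX _ LZ)).
    exact: lin_span_L2 sW.
  by rewrite [e]splitr ltrD.
Qed.

(** By linearity and continuity of the inner product. *)
Lemma orth_closed_lin_span G X Z : G `<=` L2 -> L2 X ->
  (forall g, G g -> inner X g = 0) -> closed_lin_span P G Z -> inner X Z = 0.
Proof.
move=> GL LX oG [LZ HZ].
have oS W : lin_span G W -> inner X W = 0.
  move=> [n [c [g [Gg ->]]]]; rewrite innerC (_ : inner _ X = 0) ?rmorph0//.
  elim: n c g Gg => [|n IH] c g Gg.
    under eq_fun do rewrite big_ord0; exact: inner0l.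
  under eq_fun do rewrite big_ord_recl.
  rewrite inner_linl//; [|exact/GL|by apply: L2_sum => i; exact/GL].
  by rewrite IH// addr0 innerC oG// rmorph0 mulr0.
have r0 V : (forall W, lin_span G W -> re_inner V W = 0) -> L2 V -> re_inner V Z = 0.
  move=> oV LV; apply/eqP; rewrite -normr_le0; apply/ler_addgt0Pl => e e0.
  rewrite addr0; pose M := msnorm V + 1.
  have M0 : 0 < M by rewrite /M ltr_wpDl ?msnorm_ge0.
  have [|W sW HW] := HZ (e / M); first by rewrite divr_gt0.
  have LW := lin_span_L2 GL sW.
  rewrite (_ : re_inner V Z = re_inner V (Z \- W)); last first.
    by rewrite re_innerC (re_innerC _ V) re_innerBl// (re_innerC _ W) oV// subr0.
  apply: (le_trans (re_inner_le LV (L2B LZ LW))).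
  apply: (@le_trans _ _ (M * (e / M))); last by rewrite mulrCA divff ?mulr1// gt_eqF.
  by rewrite ler_pM ?msnorm_ge0 ?ltW// /M ltrDl.
have rX : re_inner X Z = 0 by apply: r0 => // W /oS; rewrite /re_inner => ->.
apply: inner_eq0 => //.
rewrite /re_inner innerZr// (_ : complex.Re _ = re_inner (fun w => - 'i * X w) Z).
  apply: r0; last exact: L2Z.
  by move=> W sW; rewrite /re_inner innerZl ?oS ?mulr0//; exact: lin_span_L2 sW.
by rewrite /re_inner innerZl// (_ : conjc 'i = - 'i)//; exact: conjCi.
Qed.

End ClosedSubspaces.

(** * Schur complements and principal blocks *)
Section SchurComplement.
Context (C : numClosedFieldType).
Local Open Scope sesquilinear_scope.

Definition sesqf m n (M : 'M[C]_(m, n)) (x : 'cV[C]_m) (y : 'cV[C]_n) : C :=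
  (x^t* *m M *m y) ord0 ord0.

Lemma trmxC_mul m n p (A : 'M[C]_(m, n)) (B : 'M[C]_(n, p)) :
  (A *m B)^t* = B^t* *m A^t*.
Proof. by rewrite trmx_mul map_mxM. Qed.

Lemma sesqf_mul m n p q (A : 'M[C]_(m, p)) (M : 'M[C]_(m, n)) (B : 'M[C]_(n, q))
    (x : 'cV[C]_p) (y : 'cV[C]_q) :
  sesqf M (A *m x) (B *m y) = sesqf (A^t* *m M *m B) x y.
Proof. by rewrite /sesqf trmxC_mul !mulmxA. Qed.

Lemma sesqfDl m n (M : 'M[C]_(m, n)) x x' y :
  sesqf M (x + x') y = sesqf M x y + sesqf M x' y.
Proof. by rewrite /sesqf linearD map_mxD !mulmxDl mxE. Qed.

Lemma sesqfDr m n (M : 'M[C]_(m, n)) x y y' :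
  sesqf M x (y + y') = sesqf M x y + sesqf M x y'.
Proof. by rewrite /sesqf mulmxDr mxE. Qed.

Lemma sesqfB m n (M N : 'M[C]_(m, n)) x y :
  sesqf (M - N) x y = sesqf M x y - sesqf N x y.
Proof. by rewrite /sesqf mulmxBr mulmxBl mxE [in X in _ + X]mxE. Qed.

Lemma sesqfZ m n (a : C) (M : 'M[C]_(m, n)) x y :
  sesqf (a *: M) x y = a * sesqf M x y.
Proof. by rewrite /sesqf -scalemxAr -scalemxAl mxE. Qed.

Lemma hermsymmxE n (M : 'M[C]_n) : M \is hermsymmx -> M^t* = M.
Proof. by move=> /is_hermitianmxP; rewrite expr0 scale1r => <-. Qed.

Lemma posdefmx_unit n (M : 'M[C]_n) : posdefmx M -> M \in unitmx.
Proof.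
move=> [_ pM]; rewrite -row_free_unit -kermx_eq0; apply/rowV0P => v.
move=> /sub_kermxP vM; apply/eqP; rewrite -[_ == _]negbK; apply/negP => v0.
have x0 : v^t* != 0.
  by apply: contra v0 => /eqP x0; rewrite -[v]trmxCK x0 trmx0 map_mx0.
by have := pM _ x0; rewrite trmxCK vM mul0mx mxE ltxx.
Qed.

Lemma posdefmx_possemidef n (M : 'M[C]_n) : posdefmx M -> possemidefmx M.
Proof.
move=> [hM pM]; split=> // x; have [->|/pM/ltW//] := eqVneq x 0.
by rewrite mulmx0 mxE.
Qed.

Lemma sqrtmx_unit n (M : 'M[C]_n) : posdefmx M -> sqrtmx M \in unitmx.
Proof.
move=> pM; have := posdefmx_unit pM.
by rewrite -{1}(sqrtmxK pM.1) unitmx_mul => /andP[].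
Qed.

(** The inclusion of the coordinates in [A]: by [submx_ofE] it turns statements
    on blocks into identities between matrix products. *)
Definition embmx k (A : {set 'I_k}) : 'M[C]_(k, #|A|) :=
  \matrix_(i, j) (i == enum_val j)%:R.

Lemma embmx_trC k (A : {set 'I_k}) : (embmx A)^t* = (embmx A)^T.
Proof. by apply/matrixP => i j; rewrite !mxE conjC_nat. Qed.

Lemma submx_ofE k (M : 'M[C]_k) (A B : {set 'I_k}) :
  submx_of M A B = (embmx A)^t* *m M *m embmx B.
Proof.
rewrite embmx_trC; apply/matrixP => i j; rewrite !mxE.
rewrite (bigD1 (enum_val j))//= big1 ?addr0; last first.
  by move=> l /negPf lj; rewrite !mxE lj mulr0.
rewrite !mxE eqxx mulr1 (bigD1 (enum_val i))//= big1 ?addr0; last first.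
  by move=> l /negPf lj; rewrite !mxE lj mul0r.
by rewrite !mxE eqxx mul1r.
Qed.

Lemma embmxK k (A : {set 'I_k}) : (embmx A)^t* *m embmx A = 1%:M.
Proof.
have := submx_ofE 1%:M A A; rewrite mulmx1 => <-.
by apply/matrixP => i j; rewrite !mxE (inj_eq enum_val_inj).
Qed.

Lemma embmx_trK k (A : {set 'I_k}) (x : 'cV[C]_k) i :
  (embmx A *m ((embmx A)^t* *m x)) i ord0 = if i \in A then x i ord0 else 0.
Proof.
rewrite embmx_trC mxE; case: ifPn => iA; last first.
  apply: big1 => j _; rewrite !mxE; case: eqP => [E|_]; last by rewrite mul0r.
  by case/negP: iA; rewrite E enum_valP.
rewrite (bigD1 (enum_rank_in iA i))//= big1 ?addr0 => [|j ji].
  rewrite !mxE enum_rankK_in// eqxx mul1r (bigD1 i)//= big1 ?addr0.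
    by rewrite !mxE enum_rankK_in// eqxx mul1r.
  by move=> l /negPf li; rewrite !mxE enum_rankK_in// li mul0r.
rewrite !mxE; case: eqP => [E|_]; last by rewrite mul0r.
by case/eqP: ji; apply: enum_val_inj; rewrite enum_rankK_in.
Qed.

Lemma posdefmx_sub k (M : 'M[C]_k) (A : {set 'I_k}) :
  posdefmx M -> posdefmx (submx_of M A A).
Proof.
move=> [hM pM]; split.
  apply/is_hermitianmxP; rewrite expr0 scale1r submx_ofE.
  by rewrite !trmxC_mul trmxCK mulmxA (hermsymmxE hM).
move=> x x0; rewrite -[X in 0 < X]/(sesqf _ x x) submx_ofE -sesqf_mul; apply: pM.
apply: contra x0 => /eqP Ex.
by rewrite -[x]mul1mx -(embmxK A) -mulmxA Ex mulmx0.
Qed.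

(** Completing the square in the coordinates outside [A] leaves the Schur
    complement of the block indexed by [A]; the hypothesis says that this Schur
    complement dominates [e] times the block itself. *)
Lemma schur_angle k (M : 'M[C]_k) (A : {set 'I_k}) (e : C) :
  posdefmx M ->
  let SA := invmx (sqrtmx (submx_of M A A)) in
  possemidefmx ((1 - e)%:M - SA *m submx_of M A (~: A)%SET *m
    invmx (submx_of M (~: A)%SET (~: A)%SET) *m submx_of M (~: A)%SET A *m SA) ->
  forall x : 'cV[C]_k,
  let y := embmx A *m ((embmx A)^t* *m x) in e * sesqf M y y <= sesqf M x x.
Proof.
move=> pM SA [_ psd] x /=; set B := (~: A)%SET in psd *.
set u := (embmx A)^t* *m x; pose w := (embmx B)^t* *m x.
have xE : x = embmx A *m u + embmx B *m w.
  apply/colP => i; rewrite [RHS]mxE !embmx_trK finset.in_setC.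
  by case: ifP => _; rewrite ?addr0 ?add0r.
clearbody u w.
set FAA := submx_of M A A in SA psd *; set FAB := submx_of M A B in psd *.
set FBA := submx_of M B A in psd *; set FBB := submx_of M B B in psd *.
pose S := sqrtmx FAA.
have pAA : posdefmx FAA by exact: posdefmx_sub.
have pBB : posdefmx FBB by exact: posdefmx_sub.
have uS : S \in unitmx by exact: sqrtmx_unit.
have hS : S^t* = S.
  exact: hermsymmxE (sqrtmx_possemidef (posdefmx_possemidef pAA)).1.
have SS : S *m S = FAA by exact: sqrtmxK pAA.1.
have uB := posdefmx_unit pBB; have hB := hermsymmxE pBB.1.
have hBA : FBA^t* = FAB.
  by rewrite /FBA /FAB !submx_ofE !trmxC_mul trmxCK mulmxA (hermsymmxE pM.1).
have qA : sesqf M (embmx A *m u) (embmx A *m u) = sesqf FAA u u.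
  by rewrite sesqf_mul -submx_ofE.
pose G := FAB *m invmx FBB *m FBA.
have psdG : 0 <= (1 - e) * sesqf FAA u u - sesqf G u u.
  have := psd (S *m u); rewrite -[X in 0 <= X]/(sesqf _ _ _) sesqf_mul hS.
  rewrite mulmxBr mulmxBl sesqfB mul_mx_scalar -scalemxAl SS sesqfZ.
  rewrite (_ : S *m (SA *m _ *m _ *m _ *m _) *m S = G)//.
  transitivity ((S *m invmx S) *m G *m (invmx S *m S)); first by rewrite !mulmxA.
  by rewrite mulmxV// mulVmx// mul1mx mulmx1.
pose w' := w + invmx FBB *m (FBA *m u).
have psdB : 0 <= sesqf FBB w' w' by exact: (posdefmx_possemidef pBB).2.
have wE : sesqf FBB w' w' = sesqf FBB w w + sesqf FBA w u + sesqf FAB u w + sesqf G u u.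
  have E1 : sesqf FBB w (invmx FBB *m (FBA *m u)) = sesqf FBA w u.
    by rewrite /sesqf -!mulmxA mulKVmx// !mulmxA.
  have T1 : (invmx FBB *m (FBA *m u))^t* *m FBB = u^t* *m FAB.
    have V : (invmx FBB)^t* *m FBB = 1%:M.
      by rewrite -{2}hB -trmxC_mul mulmxV// trmx1 map_mx1.
    by rewrite !trmxC_mul hBA -mulmxA V mulmx1.
  rewrite sesqfDl !sesqfDr E1 /sesqf T1 -!addrA; congr (_ + (_ + (_ + _))).
  by rewrite /G !mulmxA.
have -> : sesqf M x x = sesqf FAA u u - sesqf G u u + sesqf FBB w' w'.
  rewrite wE {1 2}xE sesqfDl !sesqfDr !sesqf_mul -!submx_ofE.
  rewrite -/FAA -/FAB -/FBA -/FBB; ring.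
rewrite qA -subr_ge0 (_ : _ - _ = ((1 - e) * sesqf FAA u u - sesqf G u u) +
  sesqf FBB w' w'); first exact: addr_ge0.
by ring.
Qed.

End SchurComplement.

(** * The spectral representation and the angle between component spaces *)
Section SpectralAngle.
Context d (T : measurableType d) (R : realType) (P : probability T R) (k : nat).
Context (Y : 'I_k -> R -> T -> R[i]).
Hypothesis Y_L2 : forall v t, L2 P (Y v t).
Local Open Scope sesquilinear_scope.
Local Notation leb := (@lebesgue_measure R).

Definition cexpi (l t : R) : R[i] := cos (l * t) +i* sin (l * t).

Lemma cexpiB l s t : cexpi l (s - t) = cexpi l s * conjc (cexpi l t).
Proof.
apply: complex_ReIm_inj; rewrite ?cReM ?cImM /= mulrBr ?cosB ?sinB; ring.
Qed.

Lemma cintegrable_cexpi (g : R -> R[i]) t :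
  cintegrable leb g -> cintegrable leb (fun l => cexpi l t * g l).
Proof.
move=> [g1 g2].
(* the Lebesgue measure lives on its own copy of the measurable type [R] *)
pose RL := measurableTypeR R.
have mlt : measurable_fun setT (fun l : R => l * t) by exact: measurable_funM.
have mc : measurable_fun (setT : set RL) (fun l : RL => cos ((l : R) * t)).
  have mc' : measurable_fun setT (fun l : R => cos (l * t)).
    apply: (measurableT_comp _ mlt); apply: continuous_measurable_fun.
    exact: continuous_cos.
  exact mc'.
have ms : measurable_fun (setT : set RL) (fun l : RL => sin ((l : R) * t)).
  have ms' : measurable_fun setT (fun l : R => sin (l * t)).
    apply: (measurableT_comp _ mlt); apply: continuous_measurable_fun.
    exact: continuous_sin.
  exact ms'.
have bd (h : R -> R) : (forall l, `|h l| <= 1) -> [bounded h l | l in (setT : set RL)].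
  move=> h1; exists 1; split; first exact: num_real.
  by move=> M M1 l _; exact: le_trans (h1 l) (ltW M1).
have bc : [bounded cos ((l : R) * t) | l in (setT : set RL)].
  by apply: bd => l; rewrite ler_norml cos_geN1 cos_le1.
have bs : [bounded sin ((l : R) * t) | l in (setT : set RL)].
  by apply: bd => l; rewrite ler_norml sin_geN1 sin_le1.
split.
- have := integrableB measurableT (integrableMr measurableT mc bc g1)
    (integrableMr measurableT ms bs g2).
  by apply: eq_integrable => // l _; rewrite cReM EFinB !EFinM.
- have := integrableD measurableT (integrableMr measurableT mc bc g2)
    (integrableMr measurableT ms bs g1).
  by apply: eq_integrable => // l _; rewrite cImM EFinD !EFinM.
Qed.

Definition lincomb (I : finType) (c : I -> R[i]) (al : I -> 'I_k) (u : I -> R) :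
    T -> R[i] :=
  fun w => \sum_i c i * Y (al i) (u i) w.

(** The spectral isometry sends [Y v u] to [exp(i l u)] times the [v]-th basis
    vector; the complex conjugate is what makes the quadratic form of the
    spectral density appear as [x^* f x]. *)
Definition specvec (I : finType) (c : I -> R[i]) (al : I -> 'I_k) (u : I -> R)
    (l : R) : 'cV[R[i]]_k :=
  \col_v \sum_(i | al i == v) conjc (c i * cexpi l (u i)).

Lemma lincomb_L2 (I : finType) (c : I -> R[i]) al u : L2 P (lincomb c al u).
Proof. by apply: L2_sum => i; exact: Y_L2. Qed.

Lemma inner_lincomb (I : finType) (c : I -> R[i]) al u :
  inner P (lincomb c al u) (lincomb c al u) =
  \sum_i \sum_j c i * conjc (c j) * inner P (Y (al i) (u i)) (Y (al j) (u j)).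
Proof.
have suml (Z : T -> R[i]) : L2 P Z -> inner P (lincomb c al u) Z =
    \sum_i c i * inner P (Y (al i) (u i)) Z.
  move=> LZ; rewrite /lincomb /inner /cexpect -cintegral_sum; last first.
    by move=> i; apply: L2_mul_cintegrable.
  congr cintegral; apply/funext => w; rewrite mulr_suml.
  by apply: eq_bigr => i _; rewrite mulrA.
rewrite suml; last exact: lincomb_L2.
apply: eq_bigr => i _; rewrite innerC suml// rmorph_sum mulr_sumr.
apply: eq_bigr => j _; rewrite (innerC P (Y (al j) (u j)) (Y (al i) (u i))) -mulrA.
by congr (_ * _); exact: rmorphM.
Qed.

Lemma sum_fiber (I : finType) (al : I -> 'I_k) (g : I -> R[i]) (h : 'I_k -> R[i]) :
  \sum_v (\sum_(i | al i == v) g i) * h v = \sum_i g i * h (al i).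
Proof.
rewrite [RHS](partition_big al predT)//=; apply: eq_bigr => v _.
by rewrite mulr_suml; apply: eq_bigr => i /eqP ->.
Qed.

Lemma sesqf_specvec (I : finType) (c : I -> R[i]) al u l (M : 'M[R[i]]_k) :
  sesqf M (specvec c al u l) (specvec c al u l) =
  \sum_i \sum_j c i * conjc (c j) * (cexpi l (u i - u j) * M (al i) (al j)).
Proof.
pose g i := c i * cexpi l (u i).
rewrite /sesqf mxE.
transitivity (\sum_b (\sum_(j | al j == b) conjc (g j)) * \sum_i g i * M (al i) b).
  apply: eq_bigr => b _; rewrite [specvec _ _ _ _ b _]mxE mulrC; congr (_ * _).
  rewrite -(sum_fiber al g (fun a => M a b)) mxE; apply: eq_bigr => a _.
  rewrite !mxE; congr (_ * _); rewrite rmorph_sum; apply: eq_bigr => i _.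
  exact: conjcK.
rewrite (sum_fiber al (fun j => conjc (g j)) (fun b => \sum_i g i * M (al i) b)).
under eq_bigr do rewrite mulr_sumr.
rewrite exchange_big /=; apply: eq_bigr => i _; apply: eq_bigr => j _.
rewrite cexpiB (_ : conjc (g j) = conjc (c j) * conjc (cexpi l (u j))); last first.
  exact: rmorphM.
by rewrite /g; ring.
Qed.

(** Expanding both sides as double sums over the terms of the combination, the
    spectral density formula for the covariances matches them term by term. *)
Lemma spectral_isometry (f : R -> 'M[R[i]]_k) (I : finType) (c : I -> R[i]) al u :
  is_spectral_density P Y f ->
  cintegrable leb (fun l => sesqf (f l) (specvec c al u l) (specvec c al u l)) /\
  inner P (lincomb c al u) (lincomb c al u) =
  cintegral leb (fun l => sesqf (f l) (specvec c al u l) (specvec c al u l)).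
Proof.
move=> sd.
pose h (p : I * I) (l : R) := cexpi l (u p.1 - u p.2) * f l (al p.1) (al p.2).
pose a (p : I * I) := c p.1 * conjc (c p.2).
have ih p : cintegrable leb (h p) by apply: cintegrable_cexpi; exact: (sd _ _).1.
have E l : sesqf (f l) (specvec c al u l) (specvec c al u l) = \sum_p a p * h p l.
  by rewrite sesqf_specvec pair_bigA.
under eq_fun do rewrite E.
split; first exact: cintegrable_sum.
rewrite cintegral_sum// inner_lincomb pair_bigA; apply: eq_bigr => -[i j] _ /=.
congr (_ * _); have := (sd (al i) (al j)).2 (u j) (u i - u j).
by rewrite subrKC => ->.
Qed.

(** Setting coefficients to zero, instead of restricting the index type, keeps
    the two combinations compared in [angle_bound] over the same family. *)
Definition restr_coef (I : finType) (A : {set 'I_k}) (al : I -> 'I_k)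
  (c : I -> R[i]) (i : I) : R[i] := if al i \in A then c i else 0.

Lemma specvec_restr (I : finType) (A : {set 'I_k}) (c : I -> R[i]) al u l :
  specvec (restr_coef A al c) al u l =
  embmx R[i] A *m ((embmx R[i] A)^t* *m specvec c al u l).
Proof.
apply/colP => v; rewrite embmx_trK !mxE; case: ifPn => vA.
  by apply: eq_bigr => i /eqP iv; rewrite /restr_coef iv vA.
by apply: big1 => i /eqP iv; rewrite /restr_coef iv (negPf vA) mul0r rmorph0.
Qed.

(** Integrate [schur_angle] over the frequencies. The constant does not depend on
    the combination, which is what makes the angle between the spans of disjoint
    sets of components positive and not merely nonzero. *)
Lemma angle_bound : spectral_density_condition P Y ->
  exists e : R, 0 < e /\
    forall (A : {set 'I_k}) (I : finType) (c : I -> R[i]) al u,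
    e * sqnorm P (lincomb (restr_coef A al c) al u) <= sqnorm P (lincomb c al u).
Proof.
move=> [f [sd pf [e [/andP[e0 e1] He]]]]; exists e; split=> // A I c al u.
have dAB : (A :&: ~: A = finset.set0)%SET by rewrite finset.setICr.
have {}He := He _ _ dAB.
pose q c l := sesqf (f l) (specvec c al u l) (specvec c al u l).
have qi c' : leb.-integrable setT (fun l => (complex.Re (q c' l))%:E).
  by have [[]] := spectral_isometry c' al u sd.
have qE c' : (sqnorm P (lincomb c' al u))%:E = (\int[leb]_l (complex.Re (q c' l))%:E)%E.
  rewrite /sqnorm /re_inner (spectral_isometry c' al u sd).2 /= /Rintegral fineK//.
  exact: (integrable_fin_num measurableT (qi c')).
have q0 c' l : 0 <= complex.Re (q c' l).
  have := (posdefmx_possemidef (pf l)).2 (specvec c' al u l).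
  by rewrite -/(sesqf _ _ _) lecE => /andP[].
rewrite -lee_fin EFinM !qE -ge0_integralZl//; first last.
- by rewrite lee_fin ltW.
- by move=> l _; rewrite lee_fin.
- exact: measurable_int (qi _).
apply: ae_ge0_le_integral => //.
- by move=> l _; rewrite -EFinM lee_fin mulr_ge0// ltW.
- apply: emeasurable_funM => //; exact: measurable_int (qi _).
- by move=> l _; rewrite lee_fin.
- exact: measurable_int (qi _).
apply: (@filterS _ _ (ae_filter_ringOfSetsType leb)) He => l /= Hl _.
rewrite -EFinM lee_fin.
have := @schur_angle _ _ (f l) A e%:C (pf l) _ (specvec c al u l).
rewrite -specvec_restr rmorphB rmorph1 in Hl * => /(_ Hl) /=.
rewrite -/(q (restr_coef A al c) l) -/(q c l) lecE => /andP[_].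
by rewrite cReM /= mul0r subr0.
Qed.

End SpectralAngle.

(** * Intersections of pasts *)
Section Pasts.
Context d (T : measurableType d) (R : realType) (P : probability T R) (k : nat).
Context (Y : 'I_k -> R -> T -> R[i]).
Hypothesis Y_L2 : forall v t, L2 P (Y v t).
Implicit Types (A B S : {set 'I_k}) (X Z W : T -> R[i]).
Local Notation Lspan := (Lspan P Y).
Local Notation Lpast := (Lpast P Y).

Definition gens A (s t : \bar R) : set (T -> R[i]) :=
  [set X | exists a (u : R), [/\ a \in A, (s <= u%:E <= t)%E & X = Y a u]].

Lemma gens_L2 A s t : gens A s t `<=` L2 P.
Proof. by move=> _ [a [u [_ _ ->]]]. Qed.

Lemma gens_span A s t : gens A s t `<=` Lspan A s t.
Proof.
move=> X GX; apply: closed_lin_span_lin_span; first exact: gens_L2.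
exact: lin_span_gen.
Qed.

Lemma Lspan_csub A s t : closed_subspace P (Lspan A s t).
Proof. exact: closed_lin_span_csub (@gens_L2 A s t). Qed.

Lemma gensS A B s t : A \subset B -> gens A s t `<=` gens B s t.
Proof.
move=> /fintype.subsetP AB X [a [u [aA su ->]]].
by exists a, u; split=> //; exact: AB.
Qed.

Lemma LspanS A B s t : A \subset B -> Lspan A s t `<=` Lspan B s t.
Proof. by move=> AB; exact: closed_lin_spanS (gensS AB). Qed.

Lemma orth_Lspan A s t X : L2 P X -> (forall g, gens A s t g -> inner P X g = 0) ->
  forall W, Lspan A s t W -> inner P X W = 0.
Proof. by move=> LX o W; exact: orth_closed_lin_span (@gens_L2 A s t) LX o. Qed.

Lemma lin_span_lincomb A s t Z : lin_span (gens A s t) Z ->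
  exists n (c : 'I_n -> R[i]) al u,
    (forall i, al i \in A /\ (s <= (u i)%:E <= t)%E) /\ Z = lincomb Y c al u.
Proof.
move=> [n [c [g [Gg ->]]]].
have /choice[al Hal] : forall i, exists a, exists u : R,
    [/\ a \in A, (s <= u%:E <= t)%E & g i = Y a u] by [].
have /choice[u Hu] := Hal.
exists n, c, al, u; split.
  by move=> i; have [] := Hu i.
by apply/funext => w; apply: eq_bigr => i _; have [_ _ ->] := Hu i.
Qed.

Lemma lincomb_sum (I J : finType) (c : I -> R[i]) al u (c' : J -> R[i]) al' u' :
  lincomb Y (fun x : I + J => match x with inl i => c i | inr j => c' j end)
    (fun x => match x with inl i => al i | inr j => al' j end)
    (fun x => match x with inl i => u i | inr j => u' j end) =
  lincomb Y c al u \+ lincomb Y c' al' u'.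
Proof. by apply/funext => w; rewrite /lincomb big_sumType. Qed.

(** If [Z] in the span of [S] and [Z'] in the span of [S'] are both close to [X],
    then [Z - Z'] is small. The components in [S :\: S'] occur in [Z] only, so
    by [angle_bound] the part of [Z] that they carry is small too, and what
    remains of [Z] lies in the span of [S :&: S']. *)
Lemma Lspan_capI (sdc : spectral_density_condition P Y) S S' s t X :
  Lspan S s t X -> Lspan S' s t X -> Lspan (S :&: S')%SET s t X.
Proof.
have [e [e0 He]] := angle_bound Y_L2 sdc.
move=> [LX HX] [_ HX']; split=> // e' e'0.
pose r := Num.sqrt e; have r0 : 0 < r by rewrite sqrtr_gt0.
(* [Z] and [Z'] are chosen within [e' / M] of [X], so [M] makes the total error
   [e' / M + 2 * (e' / M) / r] equal to [e'] *)
pose M := 1 + 2 / r; have M0 : 0 < M by rewrite ltr_wpDr// ltW// divr_gt0.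
have dl0 : 0 < e' / M by rewrite divr_gt0.
have [Z sZ XZ] := HX _ dl0; have [Z' sZ' XZ'] := HX' _ dl0.
have LZ := lin_span_L2 (@gens_L2 S s t) sZ.
have LZ' := lin_span_L2 (@gens_L2 S' s t) sZ'.
have [n [c [al [u [Hal ZE]]]]] := lin_span_lincomb sZ.
have [m [c' [al' [u' [Hal' ZE']]]]] := lin_span_lincomb sZ'.
pose D := (S :\: S')%SET.
pose ZD := lincomb Y (restr_coef D al c) al u.
have LZD : L2 P ZD by exact: lincomb_L2.
exists (Z \- ZD).
  rewrite (_ : Z \- ZD = fun w => \sum_(i <- index_enum 'I_n)
      (if al i \in D then 0 else c i) * Y (al i) (u i) w); last first.
    apply/funext => w; rewrite ZE /ZD /lincomb /= -sumrB; apply: eq_bigr => i _.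
    by rewrite /restr_coef; case: ifP => _; rewrite ?subrr ?mul0r ?subr0.
  apply: lin_span_sum => i; have [aiS sui] := Hal i.
  case: ifPn => [|aiD]; [by left|right]; exists (al i), (u i); split=> //.
  by move: aiD; rewrite finset.in_setD finset.in_setI aiS andbT negbK.
have ZDE : msnorm P ZD <= msnorm P (Z \- Z') / r.
  rewrite ler_pdivlMr// -(@ler_pXn2r _ 2)// ?nnegrE ?mulr_ge0 ?msnorm_ge0 ?(ltW r0)//.
  rewrite exprMn !msnorm_sqr /r sqr_sqrtr ?(ltW e0)// mulrC.
  pose C (x : 'I_n + 'I_m) := match x with inl i => c i | inr j => - c' j end.
  pose al2 (x : 'I_n + 'I_m) := match x with inl i => al i | inr j => al' j end.
  pose u2 (x : 'I_n + 'I_m) := match x with inl i => u i | inr j => u' j end.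
  have := He D _ C al2 u2.
  rewrite (_ : lincomb Y C al2 u2 = Z \- Z'); last first.
    rewrite lincomb_sum ZE ZE'; apply/funext => w /=; congr (_ + _).
    by rewrite /lincomb -sumrN; apply: eq_bigr => i _; rewrite mulNr.
  rewrite (_ : lincomb Y (restr_coef D al2 C) al2 u2 = ZD)//.
  apply/funext => w; rewrite /lincomb big_sumType /= [X in _ + X]big1 ?addr0//.
  move=> j _; rewrite /restr_coef /= (_ : al' j \in D = false) ?mul0r//.
  by rewrite finset.in_setD (Hal' j).1.
have ZZ' : msnorm P (Z \- Z') < 2 * (e' / M).
  apply: (le_lt_trans (msnorm_triangle LZ LZ' LX)).
  by rewrite (msnorm_distC LZ LX); lra.
rewrite (_ : X \- (Z \- ZD) = (X \- Z) \+ ZD); last first.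
  by apply/funext => w /=; ring.
apply: (le_lt_trans (msnormD (L2B LX LZ) LZD)).
rewrite [ltRHS](_ : e' = e' / M + 2 * (e' / M) / r).
  by rewrite ltr_leD// (le_trans ZDE)// ler_pM2r ?invr_gt0// ltW.
by rewrite /M; field; rewrite !gt_eqF// addr_gt0.
Qed.

Lemma Lspan_capD (sdc : spectral_density_condition P Y) A s t X :
  Lspan [set: 'I_k]%SET s t X ->
  (forall v, v \in A -> Lspan ([set: 'I_k] :\: [set v])%SET s t X) ->
  Lspan ([set: 'I_k] :\: A)%SET s t X.
Proof.
move=> LX Hv.
have H (r : seq 'I_k) : {subset r <= A} -> Lspan [set v | v \notin r]%SET s t X.
  elim: r => [|v r IH] sA.
    suff -> : [set v | v \notin ([::] : seq 'I_k)]%SET = [set: 'I_k]%SET by [].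
    by apply/finset.setP => v; rewrite !finset.in_set.
  have -> : [set w | w \notin v :: r]%SET =
      (([set: 'I_k] :\: [set v]) :&: [set w | w \notin r])%SET.
    apply/finset.setP => w; rewrite finset.in_setI finset.in_setD finset.in_setT.
    by rewrite finset.in_set1 !finset.in_set in_cons negb_or andbT.
  apply: Lspan_capI => //; first by apply: Hv; apply: sA; rewrite mem_head.
  by apply: IH => w wr; apply: sA; rewrite in_cons wr orbT.
have -> : ([set: 'I_k] :\: A)%SET = [set v | v \notin enum A]%SET.
  by apply/finset.setP => v; rewrite !finset.in_set mem_enum andbT.
by apply: H => v; rewrite mem_enum.
Qed.

Lemma gen_Lspan A s t v u :
  v \in A -> (s <= u%:E <= t)%E -> Lspan A s t (Y v u).
Proof. by move=> vA su; apply: gens_span; exists v, u. Qed.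

Lemma Lpast_csub A t : closed_subspace P (Lpast A t).
Proof. exact: Lspan_csub. Qed.

Lemma Lpast_full A t : Lpast A t `<=` Lpast [set: 'I_k]%SET t.
Proof. by apply: LspanS; apply/fintype.subsetP => v _; rewrite finset.in_set. Qed.

Lemma Lspan_L2 A s t : Lspan A s t `<=` L2 P.
Proof. by move=> X [LX _]. Qed.

End Pasts.

(** * Pairwise and setwise relations *)
Section Relations.
Context d (T : measurableType d) (R : realType) (P : probability T R) (k : nat).
Context (Y : 'I_k -> R -> T -> R[i]).
Hypothesis Y_L2 : forall v t, L2 P (Y v t).
Implicit Types (A B S : {set 'I_k}) (X Z W : T -> R[i]).
Local Notation Lspan := (Lspan P Y).
Local Notation Lpast := (Lpast P Y).
Local Notation V := [set: 'I_k]%SET.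

Lemma set1_neq0 (v : 'I_k) : ([set v] = finset.set0)%SET -> False.
Proof. by move/finset.setP/(_ v); rewrite finset.in_set1 finset.in_set0 eqxx. Qed.

(** The residual [X - Z] is orthogonal to the past without [A], where the
    projections of the variables from the past of [A] lie. So orthogonality to
    the residuals of these variables is orthogonality to the variables
    themselves, and [X - Z] is orthogonal to generators of the full past. *)
Lemma cond_orth_is_proj (L1 : set (T -> R[i])) A t : L1 `<=` L2 P ->
  cond_orth P L1 (Lpast A t) (Lpast (V :\: A)%SET t) ->
  forall X, L1 X -> is_proj P (Lpast V t) X (Defs.proj P (Lpast (V :\: A)%SET t) X).
Proof.
move=> s1 co X LX; have L2X := s1 _ LX.
have cA := Lpast_csub Y_L2 (V :\: A)%SET t.
have [LZ oZ] := projP cA L2X; set Z := Defs.proj _ _ _ in LZ oZ *.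
have L2Z := csub_L2 cA LZ; have L2XZ := L2B L2X L2Z.
split; first exact: Lpast_full LZ.
apply: orth_Lspan => // g [v [u [_ su ->]]].
have [vA|vA] := boolP (v \in A); last first.
  by apply/oZ; apply: gen_Lspan su => //; rewrite !finset.in_set vA.
have Lg : Lpast A t (Y v u) by exact: gen_Lspan su.
have [Lp op] := projP cA (Y_L2 v u).
have := co _ _ LX Lg; rewrite innerBr//; last exact: (csub_L2 cA Lp).
by rewrite (oZ _ Lp) subr0.
Qed.

(** Conversely, if the projection [Z] of [X] onto the full past lies in the past
    without [A], it is also the projection onto that past, and the residual is
    orthogonal to the full past, hence to the past of [A]. *)
Lemma is_proj_cond_orth (L1 : set (T -> R[i])) A t : L1 `<=` L2 P ->
  (forall X, L1 X -> exists2 Z, is_proj P (Lpast V t) X Z & Lpast (V :\: A)%SET t Z) ->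
  cond_orth P L1 (Lpast A t) (Lpast (V :\: A)%SET t).
Proof.
move=> s1 H X W LX LW; have L2X := s1 _ LX; have [Z pZ LZ] := H _ LX.
have cA := Lpast_csub Y_L2 (V :\: A)%SET t.
have cV := Lpast_csub Y_L2 V t.
have sA : Lpast (V :\: A)%SET t `<=` Lpast V t by exact: Lpast_full.
have pA := projP cA L2X.
have pZA : is_proj P (Lpast (V :\: A)%SET t) X Z by exact: is_proj_sub pZ.
have [_ oV] := is_proj_null cV L2X pZ (sA _ pA.1) (is_proj_unique cA L2X pZA pA).
apply: oV; apply: (csubB cV); first exact: Lpast_full LW.
by apply: sA; apply: (projP cA _).1; exact: Lspan_L2 LW.
Qed.

(** The projection of the future of [B] onto the full past agrees with the
    projection onto the past without [v] for each [v] in [A], so it lies in all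
    of these pasts and therefore in the past without [A]. *)
Lemma not_causes_union (sdc : spectral_density_condition P Y) A B :
  (forall v, v \in A -> not_causes P Y [set v]%SET B V) -> not_causes P Y A B V.
Proof.
move=> H; have [A0|[v0 v0A]] := finset.set_0Vmem A; first by left.
have [B0|B0] := eqVneq B finset.set0; first by right; left.
right; right=> t.
have sB : Lspan B t%:E (t + 1)%:E `<=` L2 P.
  by move=> X; exact: Lspan_L2.
have cV := Lpast_csub Y_L2 V t.
apply: is_proj_cond_orth => // X LX; have L2X := sB _ LX.
have pV := projP cV L2X; exists (Defs.proj P (Lpast V t) X) => //.
apply: (Lspan_capD Y_L2 sdc) => [|v vA]; first exact: pV.1.
have cv := Lpast_csub Y_L2 (V :\: [set v])%SET t.
have [/set1_neq0//|[BE|/(_ t) co]] := H v vA; first by rewrite BE eqxx in B0.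
have pv := cond_orth_is_proj sB co LX.
apply: (csub_null cv (projP cv L2X).1 (csub_L2 cV pV.1)).
exact: is_proj_unique cV L2X pV pv.
Qed.

(** The residual [N] of [W] is orthogonal to the full past, so the relation for a
    variable [X] reduces to orthogonality of [X] and [N], which is linear and
    continuous in [X] and holds for the generators. *)
Lemma not_sim_union A B :
  (forall v, v \in A -> not_sim P Y [set v]%SET B V) -> not_sim P Y A B V.
Proof.
move=> H; have [B0|B0] := eqVneq B finset.set0; first by right; left.
right; right=> t X W LX LW.
have cV := Lpast_csub Y_L2 V t.
have L2X := Lspan_L2 LX.
have L2W := Lspan_L2 LW.
have [LpX _] := projP cV L2X; have [LpW oW] := projP cV L2W.
set N := W \- _; have LN : L2 P N by apply: L2B => //; exact: csub_L2 cV _ LpW.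
have dropP U : L2 P U -> inner P (U \- Defs.proj P (Lpast V t) U) N = inner P U N.
  move=> LU; have [LpU _] := projP cV LU.
  rewrite innerBl//; last exact: csub_L2 cV _ LpU.
  by rewrite (innerC P N (Defs.proj P _ U)) oW// conjc0 subr0.
rewrite dropP// innerC (_ : inner P N X = 0) ?conjc0//.
apply: (orth_Lspan Y_L2 LN _ LX) => g [v [u [vA su ->]]].
have [/set1_neq0//|[BE|/(_ t) co]] := H v vA; first by rewrite BE eqxx in B0.
rewrite innerC -dropP// co ?conjc0//.
by apply: gen_Lspan su => //; rewrite finset.in_set1.
Qed.

Lemma msD_L2 (Z : R -> T -> R[i]) t : L2 P (msD P Z t).
Proof. by rewrite /msD; case: xgetP => [X _ []//|_]; exact: L2_0. Qed.

Lemma Dj_L2 j v t : L2 P (Dj P Y j v t).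
Proof.
rewrite /Dj /msDn; case: (j v) => [|n]; first exact: Y_L2.
exact: msD_L2.
Qed.

Lemma diff_quot_L2 (Z : R -> T -> R[i]) t h : (forall s, L2 P (Z s)) ->
  L2 P (diff_quot Z t h).
Proof. by move=> LZ; apply: L2Z; exact: L2B. Qed.

(** The limit [Z] of the projections onto the full past lies in the past without
    [v] for each [v] in [A], hence in the past without [A], where it is its own
    projection. Since projections do not increase distances, the projections
    onto the past without [A] converge to [Z] at least as fast. *)
Lemma not_causes0_union (sdc : spectral_density_condition P Y) j A B :
  (forall v, v \in A -> not_causes0 P Y j [set v]%SET B V) ->
  not_causes0 P Y j A B V.
Proof.
move=> H; have [A0|[v0 v0A]] := finset.set_0Vmem A; first by left.
have [B0|B0] := eqVneq B finset.set0; first by right; left.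
right; right=> t b bB.
have {}H v : v \in A -> exists Z1 Z2,
      [/\ lim_ms P 0^'+
            (fun h => Defs.proj P (Lpast V t) (diff_quot (Dj P Y j b) t h)) Z1,
          lim_ms P 0^'+
            (fun h => Defs.proj P (Lpast (V :\: [set v])%SET t)
               (diff_quot (Dj P Y j b) t h)) Z2 &
          {ae P, forall w, Z1 w = Z2 w}].
  by move=> /H[/set1_neq0//|[BE|/(_ t b bB)//]]; rewrite BE eqxx in B0.
have LQ h : L2 P (diff_quot (Dj P Y j b) t h).
  by apply: diff_quot_L2 => s; exact: Dj_L2.
have cS S := Lpast_csub Y_L2 S t.
have LpS S h := (projP (cS S) (LQ h)).1.
have L2S S h := csub_L2 (cS S) (LpS S h).
have [Z [_ [lZ _ _]]] := H _ v0A.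
have LZ : Lpast V t Z by apply: lim_ms_csub lZ => //; exact: cS.
have LZA : Lpast (V :\: A)%SET t Z.
  apply: (Lspan_capD Y_L2 sdc) => // v vA.
  have [Z1 [Z2 [l1 l2 Z12]]] := H _ vA.
  have LZ2 : Lpast (V :\: [set v])%SET t Z2 by apply: lim_ms_csub l2 => //; exact: cS.
  have LZ1 : Lpast (V :\: [set v])%SET t Z1.
    by apply: (csub_null (cS _) LZ2 l1.1); exact: ae_eq_msnorm l1.1 l2.1 Z12.
  apply: (csub_null (cS _) LZ1 lZ.1); exact: lim_ms_unique (L2S V) lZ l1.
have lZA : lim_ms P 0^'+
    (fun h => Defs.proj P (Lpast (V :\: A)%SET t) (diff_quot (Dj P Y j b) t h)) Z.
  apply: lim_ms_dominated lZ _ => h.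
  apply: (is_proj_nonexpansive (cS (V :\: A)%SET) (L2S V h) (csub_L2 (cS V) LZ)).
    apply: (is_proj_tower (cS V) _ (LQ h)); [|exact: projP|exact: projP].
    exact: Lpast_full.
  exact: is_proj_id.
by exists Z, Z; split=> //; exact: aeW.
Qed.

End Relations.

Theorem proposition5p12 (d : measure_display) (T : measurableType d)
    (R : realType) (P : probability T R) (k : nat)
    (Y : 'I_k -> R -> T -> R[i]) :
  weakly_stationary_centered P Y ->
  ms_continuous P Y ->
  spectral_density_condition P Y ->
  purely_nondeterministic P Y ->
  local_markov (not_causes P Y) (not_sim P Y) (orthogonality_graph P Y) /\
  (forall j : 'I_k -> nat,
     (forall v : 'I_k, ms_differentiable_n P (j v) (Y v) /\
                       ~ ms_differentiable_n P (j v).+1 (Y v)) ->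
     local_markov (not_causes0 P Y j) (not_sim0 P Y j)
       (local_orthogonality_graph P Y j)).
Proof.
move=> [Y_L2 _ _] _ sdc _; split=> [a|j _ a]; split.
- apply: not_causes_union => // v.
  rewrite finset.in_setC finset.in_setU finset.in_set1 finset.in_set negb_or.
  by move=> /andP[+ va]; rewrite /= va negbK => /asboolP.
- apply: not_sim_union => // v.
  rewrite finset.in_setC finset.in_setU finset.in_set1 finset.in_set negb_or.
  by move=> /andP[+ va]; rewrite /= va negbK => /asboolP.
- apply: not_causes0_union => // v.
  rewrite finset.in_setC finset.in_setU finset.in_set1 finset.in_set negb_or.
  by move=> /andP[+ va]; rewrite /= va negbK => /asboolP.
- right; right=> t v b.
  rewrite finset.in_setC finset.in_setU finset.in_set1 finset.in_set negb_or.
  move=> /andP[+ va]; rewrite /= va negbK => /asboolP[/set1_neq0//|[/set1_neq0//|H]].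
  by move=> ba; apply: H => //; rewrite finset.in_set1.
Qed.
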